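(* Let $F$ be a color-critical graph with chromatic number $\chi(F)=r+1\ge 4$. Then there exists $m_0$ (depending on $F$) such that for every $m\ge m_0$ the following holds: if $G$ is an $F$-free graph with $m$ edges, then $$\lambda^2(G)\le \left(1-\frac{1}{r}\right)2m,$$ with equality if and only if $G$ is a regular complete $r$-partite graph (i.e. a complete $r$-partite graph with all parts of equal size).
   Context: All graphs are finite and simple; isolated vertices are ignored (a graph is identified with the graph obtained by deleting its isolated vertices). A graph $F$ is color-critical if it contains an edge whose deletion reduces its chromatic number. $G$ is $F$-free if it contains no subgraph isomorphic to $F$. $\lambda(G)$ denotes the spectral radius (largest eigenvalue) of the adjacency matrix of $G$. *)

(* Defs.v *)
From mathcomp Require Import all_boot all_order all_algebra.
From mathcomp Require Import polyrcf.
Set Implicit Arguments. Unset Strict Implicit. Unset Printing Implicit Defensive.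
Import Order.TTheory GRing.Theory Num.Theory.
Local Open Scope ring_scope.

(* A simple graph: vertex set a finType V, adjacency a symmetric irreflexive
   boolean relation e. Isolated vertices are "ignored" as explained below. *)

Section Graphs.
Variables (V : finType) (e : rel V).

Definition nonisolated (x : V) : bool := [exists y, e x y].

Definition edges : {set {set V}} := [set [set p.1; p.2] | p in [set p : V * V | e p.1 p.2]].

Definition colorable (k : nat) : bool :=
  [exists f : {ffun V -> 'I_k}, [forall x, forall y, e x y ==> (f x != f y)]].

(* chromatic number: least k with a proper k-colouring (#|V| colours suffice) *)
Definition chi : nat := \big[minn/#|V|]_(k < #|V|.+1 | colorable k) k.

Definition del_edge (x y : V) : rel V :=
  fun u v => e u v && ~~ (((u == x) && (v == y)) || ((u == y) && (v == x))).


Definition regular_complete_partite (r : nat) : Prop :=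
  exists part : V -> 'I_r,
    (forall x y, nonisolated x -> nonisolated y -> e x y = (part x != part y)) /\
    (forall i j : 'I_r,
        #|[set x | nonisolated x & part x == i]| =
        #|[set x | nonisolated x & part x == j]|).

(* adjacency matrix and spectral radius = largest (real) eigenvalue,
   i.e. the largest real root of the characteristic polynomial *)
Definition adjmx (R : nzRingType) : 'M[R]_#|V| :=
  \matrix_(i, j) (e (enum_val i) (enum_val j))%:R.

Definition spec_rad (R : rcfType) : R :=
  \big[Num.max/0]_(l <- rootsR (char_poly (adjmx R))) l.

End Graphs.

Definition color_critical (V : finType) (e : rel V) : Prop :=
  exists x y, e x y /\ (chi (del_edge e x y) < chi e)%N.

Definition F_free (V VF : finType) (e : rel V) (eF : rel VF) : Prop :=
  ~ exists f : VF -> V,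
      {in [pred x | nonisolated eF x] &, injective f} /\
      (forall x y, eF x y -> e (f x) (f y)).

(* Main.v *)
Require Import Defs.
From mathcomp Require Import all_boot all_order all_algebra.
From mathcomp Require Import perm polyrcf complex ring lra zify.
Set Implicit Arguments. Unset Strict Implicit. Unset Printing Implicit Defensive.
Import Order.TTheory GRing.Theory Num.Theory.
Local Open Scope ring_scope.

(** Put [c = 1 - 1/r], let [l] be the spectral radius, [x] a nonnegative unit
    eigenvector and weigh each vertex by [w = x^2].  Assume [l^2 >= 2cm].  Among
    the induced subgraphs take one maximizing [l^2 - 2c(1-eps)m]; it still has
    large spectral radius.  Comparing it with the deletion of a vertex [v] gives
    [w(N(v)) >= c(1-eps)(1-w(v))]: every neighbourhood has weight about [c].

    No vertex is heavy: a vertex of weight [> d] has degree of order [m], hence a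
    neighbour [t] of bounded degree; the bounded set [N[t]] has weight at least
    [c(1-eps) >= 3/5], whereas a bounded set weighs at most [1/2 + o(1)] because
    almost all arcs leaving it go to its complement.

    An F-free graph carrying a spread-out weight of minimum degree about [c] is
    [r]-partite: it contains a large complete [r]-partite graph, whose vertices
    sort almost all vertices into [r] independent classes; then every vertex
    misses one class almost completely, and an edge inside a class could be
    completed greedily to a copy of [F].

    For an [r]-partite graph, Cauchy-Schwarz over the arcs gives
    [l^2 <= 2m * (1 - sum of squared class weights) <= 2cm], with equality only
    if [x] is constant on a balanced complete [r]-partite graph (here [r >= 3] is
    used).  By the choice of the subgraph, it then has all the edges. *)

(** * Rayleigh quotients and the Perron vector *)

(** The spectral theorem is applied over [R[i]], where [A] becomes Hermitian. Its diagonal entries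
    are real, hence roots of the characteristic polynomial of [A] and at most [l]. *)
Lemma symmetric_rayleigh (R : rcfType) n (A : 'M[R]_n) (l : R) (x : 'rV[R]_n) :
  A^T = A -> (forall k, root (char_poly A) k -> k <= l) ->
  (x *m A *m x^T) 0 0 <= l * (x *m x^T) 0 0.
Proof.
move=> symA lmax.
pose f : {rmorphism R -> R[i]} := real_complex R.
pose B : 'M[R[i]]_n := map_mx f A.
have Breal : B \is a realmx.
  by apply/mxOverP => i j; rewrite mxE; apply/complex_realP; exists (A i j).
have Bsym : B \is symmetricmx.
  apply/is_hermitianmxP; rewrite expr0 scale1r map_mx_id //.
  by rewrite /B map_trmx symA.
have Bherm : B \is hermsymmx by apply: realsym_hermsym.
have /orthomx_spectralP BE := hermitian_normalmx Bherm.
have Dreal := hermitian_spectral_diag_real Bherm.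
set P := spectralmx B in BE; set D := spectral_diag B in BE Dreal.
have Pun : P \is unitarymx by apply: spectral_unitarymx.
have Puni : P \in unitmx by apply: spectral_unit.
have D_le i : D 0 i <= f l.
  have /RRe_real DE : D 0 i \is Num.real by move/mxOverP: Dreal.
  rewrite -DE lecR; apply: lmax.
  rewrite -(fmorph_root f) map_char_poly -/B [f _]DE -eigenvalue_root_char.
  apply/eigenvalueP; exists (row i P).
    rewrite -row_mul.
    have -> : P *m B = diag_mx D *m P by rewrite BE !mulmxA mulmxV // mul1mx.
    by apply/rowP => j; rewrite mul_diag_mx !mxE.
  apply/eqP => rP0; have := congr1 (row i) (mulmxV Puni).
  rewrite row_mul rP0 mul0mx => /rowP/(_ i); rewrite !mxE eqxx => /eqP.
  by rewrite eq_sym oner_eq0.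
pose X := map_mx f x; pose Y := X *m invmx P.
have XC : X^T = map_mx Num.conj X^T.
  by apply/matrixP => i j; rewrite !mxE conj_Creal //; apply/complex_realP; exists (x j i).
have PX : P *m X^T = map_mx Num.conj Y^T.
  rewrite /Y invmx_unitary // trmx_mul map_mxM -XC; congr (_ *m _); exact/esym/trmxCK.
have xAx : f ((x *m A *m x^T) 0 0) = \sum_i D 0 i * (Y 0 i * (Y 0 i)^*).
  have -> : f ((x *m A *m x^T) 0 0) = (X *m B *m X^T) 0 0.
    by rewrite /X /B map_trmx -!map_mxM [RHS]mxE.
  rewrite BE !mulmxA -[X *m _]/Y -[_ *m P *m _]mulmxA PX mul_mx_diag !mxE.
  by apply: eq_bigr => i _; rewrite !mxE mulrAC mulrC.
have xx : f ((x *m x^T) 0 0) = \sum_i (Y 0 i * (Y 0 i)^*).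
  have -> : f ((x *m x^T) 0 0) = (X *m X^T) 0 0 by rewrite /X map_trmx -!map_mxM [RHS]mxE.
  have {1}-> : X = Y *m P by rewrite /Y mulmxKV.
  by rewrite -mulmxA PX mxE; apply: eq_bigr => i _; rewrite !mxE.
rewrite -lecR -/f rmorphM /= xAx xx mulr_sumr ler_sum // => i _.
by rewrite ler_wpM2r // mul_conjC_ge0.
Qed.

Section SpectralRadius.
Variables (R : rcfType) (V : finType).
Implicit Types (e : rel V) (x y : V -> R).

Lemma spec_rad_ge0 e : 0 <= spec_rad e R.
Proof. exact: bigmax_ge_id. Qed.

Lemma mem_rootsR_char_poly n (A : 'M[R]_n) k :
  (k \in rootsR (char_poly A)) = root (char_poly A) k.
Proof. by rewrite -roots_on_rootsR ?monic_neq0 ?char_poly_monic. Qed.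

Lemma root_le_spec_rad e k : root (char_poly (adjmx e R)) k -> k <= spec_rad e R.
Proof.
rewrite -mem_rootsR_char_poly => k_root.
exact: (@le_bigmax_seq _ _ _ _ 0 k predT id).
Qed.

Lemma root_spec_rad e : 0 < spec_rad e R ->
  root (char_poly (adjmx e R)) (spec_rad e R).
Proof.
rewrite -mem_rootsR_char_poly.
(* The maximum has default value 0, so it is a root unless it is 0. *)
have: (spec_rad e R == 0) || (spec_rad e R \in rootsR (char_poly (adjmx e R))).
  rewrite /spec_rad big_seq.
  apply: (big_ind (fun l => (l == 0) || (l \in _))); first by rewrite eqxx.
    by move=> a b Pa Pb; case: leP.
  by move=> a ->; rewrite orbT.
by case/orP => [/eqP->|//]; rewrite ltxx.
Qed.

Lemma sum_enum_val (F : V -> R) : \sum_v F v = \sum_(i < #|V|) F (enum_val i).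
Proof. by rewrite (reindex _ (onW_bij _ (@enum_val_bij V))). Qed.

Lemma eq_spec_rad e1 e2 : e1 =2 e2 -> spec_rad e1 R = spec_rad e2 R.
Proof.
move=> e12; suff eqA : adjmx e1 R = adjmx e2 R by rewrite /spec_rad eqA.
by apply/matrixP => i j; rewrite !mxE e12.
Qed.

Lemma le_spec_rad e x : symmetric e ->
  \sum_u \sum_v (e u v)%:R * (x u * x v) <= spec_rad e R * \sum_u x u ^+ 2.
Proof.
move=> sym_e; pose X : 'rV[R]_#|V| := \row_i x (enum_val i).
have symA : (adjmx e R)^T = adjmx e R by apply/matrixP => i j; rewrite !mxE sym_e.
have := symmetric_rayleigh X symA (@root_le_spec_rad e).
congr (_ <= _ * _).
  rewrite -mulmxA mxE sum_enum_val; apply: eq_bigr => i _.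
  rewrite !mxE sum_enum_val mulr_sumr; apply: eq_bigr => j _.
  by rewrite !mxE mulrCA.
by rewrite mxE sum_enum_val; apply: eq_bigr => i _; rewrite !mxE.
Qed.

(** Taking absolute values [Y] of an eigenvector does not decrease the Rayleigh quotient, so the
    positive semidefinite form [q] vanishes at [Y]. A zero of such a form lies in the kernel of its
    matrix, so [Y] is again an eigenvector. *)
Lemma perron_vector e : symmetric e -> 0 < spec_rad e R ->
  exists x, [/\ forall u, 0 <= x u, \sum_u x u ^+ 2 = 1 &
    forall u, spec_rad e R * x u = \sum_v (e u v)%:R * x v].
Proof.
move=> sym_e l_gt0; set l := spec_rad e R in l_gt0 *.
have [X XA X0] : exists2 X : V -> R,
    (forall u, l * X u = \sum_v (e u v)%:R * X v) & exists u, X u != 0.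
  have := root_spec_rad l_gt0.
  rewrite -eigenvalue_root_char => /eigenvalueP[v vA /rV0Pn[i vi0]].
  exists (fun u => v 0 (enum_rank u)) => [u|]; last first.
    by exists (enum_val i); rewrite enum_valK.
  have /rowP/(_ (enum_rank u)) := vA; rewrite !mxE => <-.
  rewrite sum_enum_val; apply: eq_bigr => j _.
  by rewrite !mxE enum_rankK enum_valK sym_e mulrC.
pose q y := l * (\sum_u y u ^+ 2) - \sum_u \sum_v (e u v)%:R * (y u * y v).
have q_ge0 y : 0 <= q y by rewrite subr_ge0 le_spec_rad.
pose b y u := l * y u - \sum_v (e u v)%:R * y v.
pose Y u := `|X u|.
have qY : q Y = 0.
  apply/eqP; rewrite eq_le q_ge0 andbT subr_le0 mulr_sumr ler_sum // => u _.
  rewrite /Y expr2 mulrA -{1}(gtr0_norm l_gt0) -normrM XA mulrC.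
  rewrite -[leRHS](_ : Y u * \sum_v (e u v)%:R * Y v = _); last first.
    by rewrite mulr_sumr; apply: eq_bigr => v _; rewrite mulrCA.
  rewrite ler_wpM2l // (le_trans (ler_norm_sum _ _ _)) // ler_sum // => v _.
  by rewrite normrM normr_nat.
have qE y : q y = \sum_u y u * b y u.
  rewrite /q mulr_sumr -sumrB; apply: eq_bigr => u _; rewrite mulrBr expr2 mulrCA.
  by rewrite mulr_sumr; congr (_ - _); apply: eq_bigr => v _; rewrite mulrCA.
have bD y z t u : b (fun v => y v + t * z v) u = b y u + t * b z u.
  rewrite /b mulrDr mulrBr [t * (l * _)]mulrCA mulr_sumr addrACA -opprD -big_split.
  by congr (_ - _); apply: eq_bigr => v _; rewrite mulrDr mulrCA.
have bC y z : \sum_u y u * b z u = \sum_u z u * b y u.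
  rewrite /b; under eq_bigr do rewrite mulrBr; under [RHS]eq_bigr do rewrite mulrBr.
  rewrite !sumrB; congr (_ - _); first by apply: eq_bigr => u _; ring.
  under eq_bigr do rewrite mulr_sumr; rewrite exchange_big; apply: eq_bigr => u _.
  by rewrite mulr_sumr; apply: eq_bigr => v _; rewrite sym_e; ring.
have qD y z t :
    q (fun u => y u + t * z u) = q y + 2 * t * (\sum_u z u * b y u) + t ^+ 2 * q z.
  rewrite !qE (eq_bigr (fun u => y u * b y u + t * (y u * b z u) +
    t * (z u * b y u) + t ^+ 2 * (z u * b z u))); last first.
    by move=> u _; rewrite bD; ring.
  by rewrite !big_split -!mulr_sumr /= (bC y z); ring.
(* Moving from [Y] against the gradient [z] changes [q] by [- 2tB + t^2 q(z)], which is negative for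
   [t = B / (q z + 1)] if [B > 0]. *)
pose z := b Y; pose B := \sum_u z u * z u.
have B_ge0 : 0 <= B by apply: sumr_ge0 => u _; apply: sqr_ge0.
have B0 : B = 0.
  apply/eqP; rewrite eq_le B_ge0 andbT leNgt; apply/negP => B_gt0.
  have qz := q_ge0 z; have d_gt0 : 0 < q z + 1 by lra.
  pose t := B / (q z + 1); have t_gt0 : 0 < t by rewrite divr_gt0.
  have tq : t * (q z + 1) = B by rewrite mulfVK ?gt_eqF.
  have := q_ge0 (fun u => Y u + - t * z u); rewrite qD qY -/B; nra.
have bY u : b Y u = 0.
  by apply/eqP; rewrite -sqrf_eq0 expr2; apply/eqP; move: u isT; apply/psumr_eq0P => // u _; apply: sqr_ge0.
have S_gt0 : 0 < \sum_u Y u ^+ 2.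
  have [u Xu] := X0; rewrite lt_def sumr_ge0 ?andbT; last by move=> ? _; rewrite sqr_ge0.
  apply/eqP => /psumr_eq0P-/(_ (fun _ _ => sqr_ge0 _))/(_ u isT)/eqP.
  by rewrite sqrf_eq0 normr_eq0 (negPf Xu).
exists (fun u => Y u / Num.sqrt (\sum_u Y u ^+ 2)); split=> [u||u].
- by rewrite divr_ge0 ?sqrtr_ge0 ?normr_ge0.
- under eq_bigr => u _ do rewrite exprMn.
  by rewrite -mulr_suml exprVn sqr_sqrtr ?ltW // divff // gt_eqF.
rewrite mulrA; have /eqP := bY u; rewrite subr_eq0 => /eqP->.
by rewrite mulr_suml; apply: eq_bigr => v _; rewrite mulrA.
Qed.

End SpectralRadius.

(** * Critical pairs and greedy embedding *)

Section ChromaticNumber.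
Variables (V : finType) (e : rel V).

Lemma colorable_card : irreflexive e -> colorable e #|V|.
Proof.
move=> irr_e; apply/existsP; exists [ffun x => enum_rank x].
apply/forallP => x; apply/forallP => y; apply/implyP => exy; rewrite !ffunE.
by apply: contraTneq exy => /enum_rank_inj->; rewrite irr_e.
Qed.

Lemma colorable_chi : irreflexive e -> colorable e (chi e).
Proof.
move=> irr_e; rewrite /chi.
apply: (big_ind (fun k => colorable e k)) => //; first exact: colorable_card.
by move=> a b Ka Kb; rewrite /minn; case: ifP.
Qed.

Lemma chi_le k : colorable e k -> (chi e <= k)%N.
Proof.
move=> Kk; rewrite /chi; have [lt_Vk|le_kV] := ltnP #|V| k.
  apply: leq_trans (ltnW lt_Vk); elim/big_rec: _ => // i m _ le_m.
  by rewrite geq_min le_m orbT.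
have: Ordinal (le_kV : (k < #|V|.+1)%N) \in index_enum 'I_(#|V|.+1).
  by rewrite mem_index_enum.
elim: (index_enum _) => // i s IHs; rewrite inE big_cons => /orP[/eqP <-|/IHs le_s].
  by rewrite Kk geq_minl.
by case: ifP => // _; rewrite geq_min le_s orbT.
Qed.

End ChromaticNumber.

(** The common colour of the ends is prescribed, so that they can be aimed at any given class of the
    host graph. *)
Definition critical_pair (VF : finType) (eF : rel VF) (r : nat) (x y : VF) :=
  eF x y /\ forall i : 'I_r, exists f : VF -> 'I_r,
    [/\ f x = i, f y = i & forall z z', del_edge eF x y z z' -> f z != f z'].

(** An [r]-colouring of F without its critical edge gives both ends one colour, for otherwise it
    would colour F. A transposition of colours turns this colour into [i]. *)
Lemma color_critical_pair (VF : finType) (eF : rel VF) (r : nat) :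
  irreflexive eF -> chi eF = r.+1 -> color_critical eF ->
  exists x y, critical_pair eF r x y.
Proof.
move=> irrF chiF [x [y [xy chi_del]]]; exists x, y; split=> // i.
have irr_del : irreflexive (del_edge eF x y) by move=> z; rewrite /del_edge irrF.
have le_r : (chi (del_edge eF x y) <= r)%N by rewrite -ltnS -chiF.
have /existsP[f0 /forallP f0P] := colorable_chi irr_del.
pose f z := widen_ord le_r (f0 z).
have fP z z' : del_edge eF x y z z' -> f z != f z'.
  move=> zz'; have /forallP/(_ z')/implyP/(_ zz') := f0P z.
  by apply: contra => /eqP[/ord_inj->].
have fxy : f x = f y.
  apply/eqP; apply: contraT => fxy.
  suff: (chi eF <= r)%N by rewrite chiF ltnn.
  apply: chi_le; apply/existsP; exists (finfun f).
  apply/forallP => z; apply/forallP => z'; apply/implyP => zz'; rewrite !ffunE.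
  case del: (del_edge eF x y z z'); first exact: fP.
  move: del; rewrite /del_edge zz' /= => /negbFE /orP[]/andP[/eqP-> /eqP->] //.
  by rewrite eq_sym.
exists (fun z => tperm (f x) i (f z)); rewrite -fxy tpermL; split=> // z z' zz'.
by rewrite (inj_eq perm_inj) fP.
Qed.

Section GreedyEmbedding.
Variables (R : realFieldType) (V VF : finType) (e : rel V) (r : nat).
Implicit Types (C : 'I_r -> {set V}) (w : V -> R).

(* In a greedy embedding into the sets [C i], each vertex already chosen blocks
   at most [d + k] of the weight. *)
Definition roomy C w (d k : R) :=
  [/\ 0 <= d, 0 <= k, forall v, 0 <= w v <= d,
      forall i j u, i != j -> u \in C i -> \sum_(v in C j | ~~ e u v) w v <= k
    & forall i, #|VF|%:R * (d + k) < \sum_(v in C i) w v].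

(** The vertices are placed one by one: the at most [#|VF|] earlier ones block less than the weight
    of the next one's class. *)
Lemma greedy_embedding C w d k (f : VF -> 'I_r) (z0 : VF) :
  symmetric e -> roomy C w d k ->
  exists g : VF -> V, [/\ injective g, forall z, g z \in C (f z) &
    forall z z', f z != f z' -> e (g z) (g z')].
Proof.
move=> sym_e [d_ge0 k_ge0 w_d C_k C_w].
have w_ge0 v : 0 <= w v by case/andP: (w_d v).
have [v0 _] : exists v0, v0 \in C (f z0).
  apply/set0Pn; apply: contraTneq (C_w (f z0)) => C0; rewrite C0 big_set0 -leNgt.
  by rewrite mulr_ge0 ?addr_ge0.
suff H (s : seq VF) : uniq s -> exists g : VF -> V,
    [/\ {in s &, injective g}, {in s, forall z, g z \in C (f z)} &
        {in s &, forall z z', f z != f z' -> e (g z) (g z')}].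
  have [g [g_inj gC ge]] := H _ (enum_uniq VF).
  exists g; split=> [z z'|z|z z']; first by apply: g_inj; rewrite mem_enum.
    by apply: gC; rewrite mem_enum.
  by apply: ge; rewrite mem_enum.
elim: s => [|z s IHs] /=; first by exists (fun=> v0); split=> ?.
case/andP=> zs us; have [g [g_inj gC ge]] := IHs us.
pose bad z' v := (v == g z') || ((f z' != f z) && ~~ e (g z') v).
have [v vC v_ok] : exists2 v, v \in C (f z) & ~~ has (bad^~ v) s.
  apply/exists_inP; apply: contraT; rewrite negb_exists_in => /forall_inP all_bad.
  have := C_w (f z); rewrite ltNge => /negP[].
  have : \sum_(v in C (f z)) w v <= \sum_(z' <- s) (d + k).
    apply: (@le_trans _ _ (\sum_(v in C (f z)) \sum_(z' <- s) (bad z' v)%:R * w v)).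
      apply: ler_sum => v vC; have := all_bad v vC; rewrite negbK => /hasP[z' z's bz'].
      rewrite (big_rem z') //= bz' mul1r lerDl sumr_ge0 // => z'' _.
      by rewrite mulr_ge0 // ler0n.
    rewrite exchange_big /= big_seq [leRHS]big_seq ler_sum // => z' z's.
    apply: (@le_trans _ _ (\sum_(v in C (f z)) ((v == g z')%:R * w v +
       ((f z' != f z) && ~~ e (g z') v)%:R * w v))).
      apply: ler_sum => v _; rewrite /bad -mulrDl ler_wpM2r // -natrD ler_nat.
      by case: (v == _).
    rewrite big_split /= lerD //.
      apply: (@le_trans _ _ (\sum_(v | v == g z') w v)); last first.
        by rewrite big_pred1_eq; case/andP: (w_d (g z')).
      rewrite big_mkcond [leRHS]big_mkcond ler_sum // => v _.
      by case: (_ \in _); case: (_ == _); rewrite ?mul1r ?mul0r.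
    have [fz|fz] := eqVneq (f z') (f z).
      by rewrite big1 // => v _; rewrite mul0r.
    apply: le_trans (C_k _ _ _ fz (gC _ z's)).
    rewrite big_mkcondr ler_sum // => v _.
    by case: (e _ _); rewrite ?mul1r ?mul0r.
  move/le_trans; apply.
  rewrite big_const_seq count_predT iter_addr_0 -[leLHS]mulr_natl.
  by rewrite ler_wpM2r ?addr_ge0  // ler_nat -(card_uniqP us) max_card.
exists (fun z' => if z' == z then v else g z').
have ok z' : z' \in s -> v != g z' /\ (f z' != f z -> e (g z') v).
  move=> z's; move/hasPn/(_ z' z's): v_ok; rewrite negb_or => /andP[-> /=].
  by rewrite negb_and !negbK => /orP[/eqP->|-> //]; rewrite eqxx.
have s_neq z' : z' \in s -> (z' == z) = false.
  by move=> z's; apply: contraNF zs => /eqP<-.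
split=> [z1 z2|z1|z1 z2]; rewrite !inE.
- move=> /predU1P[->|z1s] /predU1P[->|z2s]; rewrite ?eqxx ?s_neq //.
  + by move=> vg; have [] := ok _ z2s; rewrite vg eqxx.
  + by move=> vg; have [] := ok _ z1s; rewrite vg eqxx.
  exact: g_inj.
- by case/predU1P=> [->|z1s]; rewrite ?eqxx ?s_neq // gC.
move=> /predU1P[->|z1s] /predU1P[->|z2s]; rewrite ?eqxx ?s_neq //.
- by rewrite eq_sym sym_e; case: (ok _ z2s).
- by case: (ok _ z1s).
exact: ge.
Qed.

(** If [u] and [v] were adjacent, then sending [x] to [u], [y] to [v] and the other vertices
    greedily would give a copy of F: with [x] and [y] coloured [i], their other neighbours land in
    classes joined completely to [u] and [v]. *)
Lemma critical_edge C w d k (eF : rel VF) x y u v i :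
  symmetric e -> symmetric eF -> irreflexive eF ->
  critical_pair eF r x y -> F_free e eF -> roomy C w d k ->
  (forall j z, j != i -> z \in C j -> e u z /\ e v z) ->
  u \notin C i -> v \notin C i -> irreflexive e -> ~~ e u v.
Proof.
move=> sym_e symF irrF [xy /(_ i)[f [fx fy fP]]] Ffree CR C_adj uC vC irr_e.
apply/negP => euv; apply: Ffree.
have [g [g_inj gC ge]] := greedy_embedding f x sym_e CR.
have xny : x != y by apply: contraTneq xy => ->; rewrite irrF.
have gN t : t \notin C i -> (forall j z, j != i -> z \in C j -> e t z) ->
    forall z, g z != t.
  move=> tC t_adj z; apply: contraNneq tC => gz; have := gC z; rewrite gz.
  by have [-> //|fz] := eqVneq (f z) i; move/(t_adj _ _ fz); rewrite irr_e.
have gNu : forall z, g z != u by apply: gN => // j z ji /(C_adj _ _ ji)[].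
have gNv : forall z, g z != v by apply: gN => // j z ji /(C_adj _ _ ji)[].
have uNv : u != v by apply: contraTneq euv => ->; rewrite irr_e.
have key z z' : eF z z' -> z != x -> z != y -> e (g z) (if z' == x then u
    else if z' == y then v else g z').
  move=> zz' zx zy; have fz : f z != f z'.
    by apply: fP; rewrite /del_edge zz' (negPf zx) (negPf zy).
  have [z'x|z'x] := eqVneq z' x.
    by rewrite z'x fx in fz; rewrite sym_e; case: (C_adj _ _ fz (gC z)).
  have [z'y|z'y] := eqVneq z' y; last exact: ge.
  by rewrite z'y fy in fz; rewrite sym_e; case: (C_adj _ _ fz (gC z)).
exists (fun z => if z == x then u else if z == y then v else g z); split.
  move=> z z' _ _; have [->|zx] := eqVneq z x; have [->|z'x] := eqVneq z' x => //.
  - have [_ /eqP|_ /eqP] := eqVneq z' y; first by rewrite (negPf uNv).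
    by rewrite eq_sym (negPf (gNu _)).
  - have [_ /eqP|_ /eqP] := eqVneq z y; first by rewrite eq_sym (negPf uNv).
    by rewrite (negPf (gNu _)).
  have [->|zy] := eqVneq z y; have [->|z'y] := eqVneq z' y => //.
  - by move/eqP; rewrite eq_sym (negPf (gNv _)).
  - by move/eqP; rewrite (negPf (gNv _)).
  exact: g_inj.
move=> z z' zz'; case zP: ((z == x) || (z == y)); last first.
  move/negbT: zP; rewrite negb_or => /andP[zx zy].
  by rewrite (negPf zx) (negPf zy); apply: key.
case z'P: ((z' == x) || (z' == y)); last first.
  move/negbT: z'P; rewrite negb_or => /andP[zx zy].
  by rewrite sym_e (negPf zx) (negPf zy); apply: key; rewrite // symF.
by case/orP: zP zz' => /eqP->; case/orP: z'P => /eqP->;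
  rewrite ?irrF // ?eqxx // [y == x]eq_sym (negPf xny) // sym_e.
Qed.

(** Removing [x] from F removes the critical edge too, so the rest is [r]-coloured and embeds
    greedily; a vertex [v] joined to all classes could play [x]. *)
Lemma critical_hub C w d k (eF : rel VF) x y v (i : 'I_r) :
  symmetric e -> symmetric eF -> irreflexive eF ->
  critical_pair eF r x y -> F_free e eF -> roomy C w d k -> irreflexive e ->
  ~ (forall j z, z \in C j -> e v z).
Proof.
move=> sym_e symF irrF [xy /(_ i)[f [fx fy fP]]] Ffree CR irr_e C_adj; apply: Ffree.
have [g [g_inj gC ge]] := greedy_embedding f x sym_e CR.
have gNv z : g z != v by apply: contraTneq (C_adj _ _ (gC z)) => ->; rewrite irr_e.
exists (fun z => if z == x then v else g z); split.
  move=> z z' _ _; have [->|zx] := eqVneq z x; have [->|z'x] := eqVneq z' x => //.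
  - by move/eqP; rewrite eq_sym (negPf (gNv _)).
  - by move/eqP; rewrite (negPf (gNv _)).
  exact: g_inj.
move=> z z' zz'; have [zx|zx] := eqVneq z x; have [z'x|z'x] := eqVneq z' x.
- by rewrite zx z'x irrF in zz'.
- exact: C_adj (gC _).
- by rewrite sym_e; apply: C_adj (gC _).
by apply/ge/fP; rewrite /del_edge zz' (negPf zx) (negPf z'x) andbF.
Qed.

End GreedyEmbedding.

(** * Complete multipartite subgraphs of dense weighted graphs *)

Section SetTake.
Variable V : finType.

Definition set_take t (A : {set V}) := [set x in take t (enum A)].

Lemma set_take_sub t A : set_take t A \subset A.
Proof. by apply/subsetP => x; rewrite inE => /mem_take; rewrite mem_enum. Qed.

Lemma card_set_take t (A : {set V}) : (t <= #|A|)%N -> #|set_take t A| = t.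
Proof.
move=> le_tA; rewrite cardsE (card_uniqP _) ?take_uniq ?enum_uniq //.
by rewrite size_take -cardE; case: ltngtP le_tA.
Qed.

Lemma card_bigcup_le n (B : 'I_n -> {set V}) :
  (#|\bigcup_i B i| <= \sum_i #|B i|)%N.
Proof.
elim/big_rec2: _ => [|i k A _ le_A]; first by rewrite cards0.
by rewrite (leq_trans (leq_card_setU _ _)) // leq_add2l.
Qed.

End SetTake.

(** The value [1 - 1/r] is the weight of a neighbourhood in a balanced complete [r]-partite graph.
    One parameter [d] is both the cap on single weights and the slack of the degree condition. *)
Definition dense_weight (R : realFieldType) (V : finType) (e : rel V)
    (w : V -> R) (r : nat) (d : R) :=
  [/\ \sum_v w v = 1, forall v, 0 <= w v <= d,
      forall v, ~~ nonisolated e v -> w v = 0 &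
      forall v, nonisolated e v -> 1 - r%:R^-1 - d <= \sum_(u | e v u) w u].

Lemma dense_weight_ge0 (R : realFieldType) (V : finType) (e : rel V) (w : V -> R) r d :
  dense_weight e w r d -> 0 <= d.
Proof.
case=> w1 w_d _ _; rewrite leNgt; apply/negP => d_lt0; suff: \sum_v w v <= 0.
  by rewrite w1 ler10.
by apply: sumr_le0 => v _; case/andP: (w_d v) => _ /le_trans->//; rewrite ltW.
Qed.

(** Parts are indexed by [nat], with only indices below [s] constrained, so that [s] can grow by
    induction. *)
Definition complete_parts (V : finType) (e : rel V) (s t : nat) (B : nat -> {set V}) :=
  [/\ forall i, (i < s)%N -> #|B i| = t,
      forall i b, (i < s)%N -> b \in B i -> nonisolated e b &
      forall i j u v, (i < s)%N -> (j < s)%N -> i != j ->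
        u \in B i -> v \in B j -> e u v].

Section DenseWeight.
Variables (R : realFieldType) (V : finType) (e : rel V) (w : V -> R).
Variables (r s T : nat) (d : R) (B : nat -> {set V}).
Hypotheses (sym_e : symmetric e) (e_dense : dense_weight e w r d).
Hypothesis (B_parts : complete_parts e s T B).

Definition hits (i : nat) (v : V) := #|[set b in B i | e b v]|.

Lemma hits_le i v : (i < s)%N -> (hits i v <= T)%N.
Proof.
by case: B_parts => cB _ _ /cB <-; apply/subset_leq_card/subsetP => b; rewrite inE => /andP[].
Qed.

(** Double counting of the total neighbourhood weight of the [s * T] vertices in the parts. *)
Lemma dense_hits : (s * T)%:R * (1 - r%:R^-1 - d) <=
  \sum_v w v * \sum_(i < s) (hits i v)%:R.
Proof.
have [cB nB _] := B_parts; have [_ _ _ degw] := e_dense.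
have -> : \sum_v w v * \sum_(i < s) (hits i v)%:R =
    \sum_(i < s) \sum_(b in B i) \sum_(v | e b v) w v.
  under eq_bigr do rewrite mulr_sumr.
  rewrite exchange_big; apply: eq_bigr => i _ /=.
  under [RHS]eq_bigr do rewrite big_mkcond.
  rewrite exchange_big; apply: eq_bigr => v _ /=.
  rewrite -big_mkcondr /= /hits -sum1_card natr_sum mulr_sumr.
  by apply: eq_big => [b|b _]; rewrite ?inE ?mulr1.
have -> : (s * T)%:R * (1 - r%:R^-1 - d) =
    \sum_(i < s) \sum_(b in B i) (1 - r%:R^-1 - d).
  under eq_bigr => i _ do rewrite sumr_const cB //.
  by rewrite sumr_const card_ord -mulrnA mulr_natl mulnC.
by apply: ler_sum => i _; apply: ler_sum => b bB; apply/degw/(nB i).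
Qed.

End DenseWeight.

(** The induction step of the Erdős-Stone argument. The vertices [X] with at least [t] neighbours in
    every part have weight at least [1/(2r)]. As single weights are small, [t] of them have the same
    neighbours in the parts; these form the new part, and the old parts shrink to common
    neighbours. *)
Lemma complete_parts_extend (R : realFieldType) (V : finType) (e : rel V)
    (w : V -> R) (r s t : nat) (d : R) (B : nat -> {set V}) (T := (4 * r * t.+1)%N) :
  symmetric e -> dense_weight e w r d -> (s < r)%N -> complete_parts e s T B ->
  d * (4 * r ^ 2)%:R <= 1 -> d * (2 * r * 2 ^ (s * T) * t.+1)%:R <= 1 ->
  exists B', complete_parts e s.+1 t B'.
Proof.
move=> sym_e e_dense lt_sr B_parts d_small1 d_small2.
have [w1 w_d w_iso degw] := e_dense; have [cB nB eB] := B_parts.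
have r_gt0 : 0 < r%:R :> R by rewrite ltr0n (leq_ltn_trans _ lt_sr).
have w_ge0 v : 0 <= w v by case/andP: (w_d v).
have d_ge0 := dense_weight_ge0 e_dense.
pose X := [set v | nonisolated e v & [forall i : 'I_s, t <= hits e B i v]%N].
have X_large : (2 * r%:R)^-1 <= \sum_(v in X) w v.
  have := dense_hits e_dense B_parts.
  (* A vertex outside [X] has at most [(s - 1) * T + t] neighbours in the parts; one in [X] has at
     most [s * T]. *)
  have : \sum_v w v * (\sum_(i < s) (hits e B i v)%:R) <=
      \sum_v (w v * (s * T + t)%:R - w v * T%:R + (v \in X)%:R * w v * T%:R).
    apply: ler_sum => v _.
    have [v_iso|v_iso] := boolP (nonisolated e v); last by rewrite w_iso // !(mul0r, mulr0) subr0 addr0.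
    have hT (i : 'I_s) : (hits e B i v)%:R <= T%:R :> R.
      by rewrite ler_nat; apply: (hits_le B_parts).
    have sT : \sum_(i < s) T%:R = (s * T)%:R :> R.
      by rewrite sumr_const card_ord -mulrnA mulnC.
    rewrite -mulrBr [_%:R * w v]mulrC -mulrA -mulrDr ler_wpM2l //.
    have [vX|vX] := boolP (v \in X).
      rewrite mul1r subrK natrD -sT (le_trans (ler_sum _ (fun i _ => hT i))) //.
      by rewrite lerDl ler0n.
    rewrite mul0r addr0; move: vX; rewrite inE v_iso /= negb_forall => /existsP[i0].
    rewrite -ltnNge => lt_t; rewrite natrD -sT !(bigD1 i0 (P := predT)) //=.
    have : (hits e B i0 v)%:R <= t%:R :> R by rewrite ler_nat ltnW.
    have : \sum_(i < s | i != i0) (hits e B i v)%:R <= \sum_(i < s | i != i0) T%:R :> R.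
      by apply: ler_sum.
    lra.
  have -> : \sum_v (w v * (s * T + t)%:R - w v * T%:R + (v \in X)%:R * w v * T%:R) =
      (s * T + t)%:R - T%:R + (\sum_(v in X) w v) * T%:R.
    rewrite !big_split /= sumrN -!mulr_suml w1 !mul1r; congr (_ + _ * _).
    by rewrite [RHS]big_mkcond; apply: eq_bigr => v _; case: (_ \in _); rewrite ?mul1r ?mul0r.
  set W := \sum_(v in X) w v => le1 le2.
  have rV : r%:R * r%:R^-1 = 1 :> R by rewrite divff ?gt_eqF.
  have TE : T%:R = 4 * r%:R * (t%:R + 1) :> R by rewrite /T !natrM -[t.+1%:R]natr1.
  have le_s : s%:R + 1 <= r%:R :> R by rewrite natr1 ler_nat.
  have s_ge0 : 0 <= s%:R :> R by [].
  have t_ge0 : 0 <= t%:R :> R by [].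
  have {}d_small1 : d * r%:R ^+ 2 * 4 <= 1 by move: d_small1; rewrite natrM natrX; lra.
  rewrite invfM.
  set rv := r%:R^-1 in rV le2 *.
  have T_gt0 : 0 < T%:R :> R by rewrite TE; nra.
  have {le1 le2} : T%:R * (1 - s%:R * rv - s%:R * d) - t%:R <= W * T%:R.
    by move: (le_trans le2 le1); rewrite natrD natrM; lra.
  have : t%:R <= T%:R * (rv / 4) by rewrite TE; nra.
  have : s%:R * rv <= 1 - rv by nra.
  have : s%:R * d <= rv / 4.
    have : s%:R * d <= r%:R * d by nra.
    have : r%:R * d * 4 <= rv.
      have rv_gt0 : 0 < rv by rewrite invr_gt0.
      have -> : r%:R * d * 4 = d * r%:R ^+ 2 * 4 * rv.
        by transitivity (r%:R * d * 4 * (r%:R * rv)); [rewrite rV mulr1 | ring].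
      by rewrite ger_pMl.
    lra.
  move=> le1 le2 le3 le4.
  have : T%:R * (rv / 2) <= W * T%:R by nra.
  by rewrite [leLHS]mulrC ler_pM2r // mulrC.
pose BB := \bigcup_(i < s) B i.
pose phi v := [set b in BB | e b v].
have BB_card : (#|BB| <= s * T)%N.
  rewrite (leq_trans (card_bigcup_le _)) //.
  by rewrite (eq_bigr (fun=> T)) ?sum_nat_const ?card_ord // => i _; rewrite cB.
(* Pigeonhole over the at most [2 ^ (s * T)] traces [phi v] on the union of the parts. *)
have [P P_large] : exists P, (t <= #|[set v in X | phi v == P]|)%N.
  apply/existsP; apply: contraT; rewrite negb_exists => /forallP noP.
  have : \sum_(v in X) w v <= \sum_(P in powerset BB) d * t%:R.
    rewrite (partition_big phi (mem (powerset BB))) => [|v _] /=; last first.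
      by rewrite inE; apply/subsetP => b; rewrite inE => /andP[].
    apply: ler_sum => P _; apply: le_trans (_ : \sum_(v in X | phi v == P) d <= _).
      by apply: ler_sum => v _; case/andP: (w_d v).
    rewrite (eq_bigl (mem [set v in X | phi v == P])); last by move=> v; rewrite [RHS]inE.
    rewrite sumr_const -[leLHS]mulr_natr ler_wpM2l // ler_nat.
    by have := noP P; rewrite -ltnNge => /ltnW.
  rewrite sumr_const card_powerset -[d * t%:R *+ _]mulr_natr => W_le.
  have {}W_le : \sum_(v in X) w v <= d * t%:R * (2 ^ (s * T))%:R.
    by rewrite (le_trans W_le) // ler_wpM2l ?mulr_ge0 // ler_nat leq_pexp2l.
  have := le_trans X_large W_le; rewrite invfM -(ler_pM2l (_ : 0 < 2 * r%:R :> R)); last by rewrite mulr_gt0.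
  rewrite mulrACA !divff ?gt_eqF // mulr1.
  (* The gap between [t] and [t.+1] forces [d * r * K = 0], which contradicts the lower bound on the
     weight of [X]. *)
  move: d_small2; rewrite 3!natrM -[t.+1%:R]natr1; set K := (2 ^ _)%:R => le1 le2.
  have K_ge0 : 0 <= K :> R by rewrite ler0n.
  have t_ge0 : 0 <= t%:R :> R by [].
  have z_ge0 : 0 <= d * r%:R * K by rewrite !mulr_ge0 // ltW.
  have : d * r%:R * K = 0 by lra.
  by move=> z0; have : 2 * r%:R * (d * t%:R * K) = 0; [rewrite -[RHS](mul0r (2 * t%:R)) -z0; ring | lra].
set Y := [set v in X | phi v == P] in P_large.
have [t0|t_gt0] := posnP t.
  by exists (fun=> set0); split=> [i _|i b _|i j u v _ _ _]; rewrite ?inE ?cards0.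
have [y yY] : exists y, y \in Y by apply/set0Pn; rewrite -card_gt0 (leq_trans t_gt0).
(* All of [Y] has trace [P], so one member [y] of [X] shows that [P] meets every part often
   enough. *)
have P_hits i : (i < s)%N -> (t <= #|P :&: B i|)%N.
  move=> lt_is; move: yY; rewrite inE => /andP[]; rewrite inE => /andP[_].
  move=> /forallP/(_ (Ordinal lt_is)) le_t /eqP<-.
  apply: (leq_trans le_t); apply/subset_leq_card/subsetP => b; rewrite !inE => /andP[bB ->].
  by rewrite bB !andbT; apply/bigcupP; exists (Ordinal lt_is).
pose B' i := set_take t (if (i < s)%N then P :&: B i else Y).
have B'B i b : (i < s)%N -> b \in B' i -> b \in B i /\ b \in P.
  move=> lt_is /(subsetP (set_take_sub _ _)); rewrite lt_is inE => /andP[-> ->] //.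
have B'Y b : b \in B' s -> b \in Y.
  by move/(subsetP (set_take_sub _ _)); rewrite ltnn.
have YP b v : v \in Y -> b \in P -> e b v.
  by rewrite inE => /andP[_ /eqP <-]; rewrite inE => /andP[].
exists B'; split=> [i|i b|i j u v].
- rewrite ltnS leq_eqVlt => /predU1P[->|lt_is]; rewrite /B' ?ltnn ?lt_is card_set_take //.
  exact: P_hits.
- rewrite ltnS leq_eqVlt => /predU1P[->|lt_is].
    by move/B'Y; rewrite inE => /andP[]; rewrite inE => /andP[].
  by case/(B'B _ _ lt_is) => /(nB _ _ lt_is).
rewrite !ltnS (leq_eqVlt i) (leq_eqVlt j) => /predU1P[->|lt_is] /predU1P[->|lt_js]; rewrite ?eqxx //.
- by move=> _ /B'Y uY /(B'B _ _ lt_js)[_ vP]; rewrite sym_e YP.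
- by move=> _ /(B'B _ _ lt_is)[_ uP] /B'Y vY; rewrite YP.
by move=> ij /(B'B _ _ lt_is)[uB _] /(B'B _ _ lt_js)[vB _]; apply: eB uB vB.
Qed.

(** [N] is the sum of the demands of the induction hypothesis, taken for parts of size
    [4 * r * t.+1], and of the extension step. *)
Lemma complete_parts_exist r s t : (s <= r)%N -> exists N : nat,
  forall (R : realFieldType) (V : finType) (e : rel V) (w : V -> R) (d : R),
    symmetric e -> dense_weight e w r d -> d * N%:R <= 1 ->
    exists B, complete_parts e s t B.
Proof.
elim: s t => [|s IHs] t le_sr; first by exists 0%N => *; exists (fun=> set0); split.
have [N0 N0P] := IHs (4 * r * t.+1)%N (ltnW le_sr).
exists (N0 + 4 * r ^ 2 + 2 * r * 2 ^ (s * (4 * r * t.+1)) * t.+1)%N.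
move=> R V e w d sym_e e_dense; have d_ge0 := dense_weight_ge0 e_dense.
move=> d_small.
have small n : (n <= N0 + 4 * r ^ 2 + 2 * r * 2 ^ (s * (4 * r * t.+1)) * t.+1)%N ->
    d * n%:R <= 1.
  by move=> le_n; apply: le_trans d_small; rewrite ler_wpM2l // ler_nat.
have [|B BP] := N0P R V e w d sym_e e_dense; first by rewrite small // -addnA leq_addr.
apply: complete_parts_extend BP _ _ => //; first exact: e_dense.
  by rewrite small // addnAC leq_addl.
by rewrite small // leq_addl.
Qed.

(** * Dense weighted F-free graphs are r-partite *)

Section WeightedSums.
Variables (R : realFieldType) (V : finType) (w : V -> R).
Hypothesis w_ge0 : forall v, 0 <= w v.

(** Indicators are compared pointwise as numbers, so that disjointness and inclusion reduce to a
    case analysis on booleans. *)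
Lemma sum_packing (P Q S T : pred V) :
  (forall v, P v + Q v + S v <= T v)%N ->
  \sum_(v | P v) w v + \sum_(v | Q v) w v + \sum_(v | S v) w v <= \sum_(v | T v) w v.
Proof.
move=> H; rewrite [\sum_(v | P v) _]big_mkcond [\sum_(v | Q v) _]big_mkcond.
rewrite [\sum_(v | S v) _]big_mkcond [\sum_(v | T v) _]big_mkcond.
rewrite -!big_split ler_sum //= => v _.
have w0 := w_ge0 v.
by have := H v; case: (P v); case: (Q v); case: (S v); case: (T v) => //= _; lra.
Qed.

Lemma sum_covering (P Q S T : pred V) :
  (forall v, T v <= P v + Q v + S v)%N ->
  \sum_(v | T v) w v <= \sum_(v | P v) w v + \sum_(v | Q v) w v + \sum_(v | S v) w v.
Proof.
move=> H; rewrite [\sum_(v | P v) _]big_mkcond [\sum_(v | Q v) _]big_mkcond.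
rewrite [\sum_(v | S v) _]big_mkcond [\sum_(v | T v) _]big_mkcond.
rewrite -!big_split ler_sum //= => v _.
have w0 := w_ge0 v.
by have := H v; case: (P v); case: (Q v); case: (S v); case: (T v) => //= _; lra.
Qed.

End WeightedSums.

Section ApproximatePartition.
Variables (R : realFieldType) (V VF : finType) (e : rel V) (eF : rel VF).
Variables (w : V -> R) (r t : nat) (d : R) (B : nat -> {set V}) (x y : VF).
Hypotheses (sym_e : symmetric e) (irr_e : irreflexive e) (e_dense : dense_weight e w r d).
Hypotheses (symF : symmetric eF) (irrF : irreflexive eF).
Hypotheses (xyF : critical_pair eF r x y) (Ffree : F_free e eF).
Hypotheses (B_parts : complete_parts e r t B).
Hypotheses (r_gt0 : (0 < r)%N) (t_large : (4 * (#|VF| + 3) <= t)%N).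

Let i0 : 'I_r := Ordinal r_gt0.
Let w_ge0 v : 0 <= w v. Proof. by case: e_dense => _ /(_ v)/andP[]. Qed.
Let d_ge0 := dense_weight_ge0 e_dense.

(** With the proportion three quarters, two vertices of one core have at least half of every other
    part in common. *)
Definition core (i : 'I_r) : {set V} := [set v | nonisolated e v &
  [forall j : 'I_r, (j != i) ==> (3 * t <= 4 * hits e B j v)%N]].

Lemma core_hits i j v : v \in core i -> j != i -> (3 * t <= 4 * hits e B j v)%N.
Proof. by rewrite inE => /andP[_ /forallP/(_ j)/implyP]. Qed.

Let sum_one (A : {set V}) : \sum_(v in A) (1 : R) = #|A|%:R.
Proof. by rewrite sumr_const. Qed.

(** Under the counting weight no edge is missing between complete parts, so room only requires more
    than [#|VF|] vertices. *)
Lemma roomy_parts (C : 'I_r -> {set V}) :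
  (forall i, C i \subset B i) -> (forall i, #|VF| < #|C i|)%N ->
  roomy VF e C (fun=> 1 : R) 1 0.
Proof.
move=> CB C_large; split=> [||v|i j u ij uC|i]; rewrite ?lexx ?ler01 //.
  rewrite big1 // => v /andP[vC /negP[]]; case: B_parts => _ _; apply=> //.
  - exact: ij.
  - exact: (subsetP (CB i)).
  - exact: (subsetP (CB j)).
by rewrite addr0 mulr1 sum_one ltr_nat.
Qed.

(** Otherwise [v] would be a hub over its own neighbours in the parts. *)
Lemma few_hits v : exists i : 'I_r, (hits e B i v <= #|VF|)%N.
Proof.
apply/existsP; apply: contraT; rewrite negb_exists => /forallP all_hits.
pose C (i : 'I_r) := [set b in B i | e b v].
have CR : roomy VF e C (fun=> 1 : R) 1 0.
  apply: roomy_parts => i; last by rewrite ltnNge all_hits.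
  by apply/subsetP => b; rewrite inE => /andP[].
case: (critical_hub i0 (v := v) sym_e symF irrF xyF Ffree CR irr_e).
by move=> j z; rewrite inE sym_e => /andP[].
Qed.

(** The common neighbours of [u] and [v] in the other parts, with [B i] minus [u] and [v], leave
    room for [critical_edge]. *)
Lemma core_independent i u v : u \in core i -> v \in core i -> ~~ e u v.
Proof.
move=> uA vA; pose C (j : 'I_r) := if j == i then B i :\: [set u; v]
  else [set b in B j | e b u && e b v].
have [cB _ _] := B_parts.
have CR : roomy VF e C (fun=> 1 : R) 1 0.
  apply: roomy_parts => j; rewrite /C; have [ji|ji] := eqVneq j i.
  - by rewrite ji subsetDl.
  - by apply/subsetP => b; rewrite inE => /andP[].
  - have := cardsID [set u; v] (B i); rewrite cB //.
    have := subset_leq_card (subsetIr (B i) [set u; v]); have := cards2 u v; lia.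
  have := core_hits uA ji; have := core_hits vA ji; rewrite /hits.
  have := cardsUI [set b in B j | e b u] [set b in B j | e b v].
  have -> : [set b in B j | e b u] :&: [set b in B j | e b v] =
     [set b in B j | e b u && e b v].
    by apply/setP => b; rewrite !inE andbACA andbb.
  have : (#|[set b in B j | e b u] :|: [set b in B j | e b v]| <= t)%N.
    rewrite -(cB j (ltn_ord j)); apply/subset_leq_card/subsetP => b.
    by rewrite !inE => /orP[]/andP[].
  by lia.
apply: (critical_edge (i := i) sym_e symF irrF xyF Ffree CR _ _ _ irr_e).
- move=> j z ji; rewrite /C (negPf ji) inE [e u z]sym_e [e v z]sym_e.
  by case/and3P.
- by rewrite /C eqxx !inE eqxx.
by rewrite /C eqxx !inE eqxx orbT.
Qed.

Lemma core_disjoint i j v : v \in core i -> v \in core j -> i = j.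
Proof.
move=> vi vj; apply/eqP; apply: contraT => ij; have [k] := few_hits v.
have [ki|ki] := eqVneq k i; last by have := core_hits vi ki; lia.
by rewrite ki; have := core_hits vj ij; lia.
Qed.

Definition off_core : {set V} := [set v | nonisolated e v & [forall i, v \notin core i]].

(** Every vertex misses nearly all of one part by [few_hits], and one off the cores misses more than
    a quarter of a second part. By [dense_hits] the average miss is at most [t + r * t * d]. *)
Lemma weight_off_core : t%:R * \sum_(v in off_core) w v <= 4 * (#|VF|%:R + r%:R * t%:R * d).
Proof.
have [w1 w_d w_iso degw] := e_dense; have [cB nB eB] := B_parts.
have := dense_hits e_dense B_parts.
have : \sum_v w v * (\sum_(i < r) (hits e B i v)%:R) <=
    \sum_v (w v * (r * t)%:R - w v * (t%:R - #|VF|%:R) - (v \in off_core)%:R * w v * (t%:R / 4)).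
  apply: ler_sum => v _.
  have [v_iso|v_iso] := boolP (nonisolated e v); last first.
    by rewrite w_iso // !(mul0r, mulr0) !subr0.
  rewrite -mulrBr [_%:R * w v]mulrC -[w v * _ * _]mulrA -mulrBr ler_wpM2l //.
  have hT (i : 'I_r) : (hits e B i v)%:R <= t%:R :> R.
    by rewrite ler_nat; apply: (hits_le B_parts).
  have -> : (r * t)%:R = \sum_(i < r) t%:R :> R by rewrite sumr_const card_ord -mulrnA mulnC.
  have [i hi] := few_hits v; have {}hi : (hits e B i v)%:R <= #|VF|%:R :> R by rewrite ler_nat.
  rewrite !(bigD1 i (P := predT)) //=.
  have [vE|vE] := boolP (v \in off_core); last first.
    rewrite mul0r; suff : \sum_(j < r | j != i) (hits e B j v)%:R <= \sum_(j < r | j != i) t%:R :> R by lra.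
    by apply: ler_sum.
  rewrite mul1r; move: vE; rewrite inE v_iso => /forallP/(_ i); rewrite inE v_iso negb_forall /=.
  case/existsP=> j; rewrite negb_imply -ltnNge => /andP[ji hj].
  rewrite !(bigD1 j ji) /=.
  have : \sum_(k < r | (k != i) && (k != j)) (hits e B k v)%:R <=
     \sum_(k < r | (k != i) && (k != j)) t%:R :> R by apply: ler_sum.
  have : 4 * (hits e B j v)%:R <= 3 * t%:R :> R by rewrite -!natrM ler_nat ltnW.
  lra.
have -> : \sum_v (w v * (r * t)%:R - w v * (t%:R - #|VF|%:R) - (v \in off_core)%:R * w v * (t%:R / 4)) =
    (r * t)%:R - (t%:R - #|VF|%:R) - (\sum_(v in off_core) w v) * (t%:R / 4).
  rewrite !big_split /= !sumrN -!mulr_suml w1 !mul1r; congr (_ - _ * _).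
  by rewrite [RHS]big_mkcond; apply: eq_bigr => v _; case: (_ \in _); rewrite ?mul1r ?mul0r.
set W := \sum_(v in off_core) w v; rewrite natrM => le1 le2.
have rV : r%:R * r%:R^-1 = 1 :> R by rewrite divff // pnatr_eq0 -lt0n.
have : r%:R * t%:R * (1 - r%:R^-1 - d) = r%:R * t%:R - t%:R - r%:R * t%:R * d.
  by transitivity (r%:R * t%:R - r%:R * r%:R^-1 * t%:R - r%:R * t%:R * d); [ring | rewrite rV mul1r].
move: (le_trans le2 le1); lra.
Qed.

Let rho := \sum_(v in off_core) w v.
(** [k] will bound the weight that a vertex of one core misses in another core, and [eta] the weight
    blocked during a greedy embedding of F. *)
Let k := rho + (r%:R + 1) * d.
Let eta := #|VF|%:R * (d + k).

Let r_gt0R : 0 < r%:R :> R. Proof. by rewrite ltr0n. Qed.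
Let rho_ge0 : 0 <= rho. Proof. by apply: sumr_ge0 => v _; apply: w_ge0. Qed.
Let le_dk : d <= k.
Proof. by rewrite /k; have := mulr_ge0 (ltW r_gt0R) d_ge0; have := rho_ge0; lra. Qed.
Let sum_w : \sum_(v | predT v) w v = 1. Proof. by case: e_dense. Qed.

Lemma weight_core_le i : \sum_(v in core i) w v <= r%:R^-1 + d.
Proof.
have [A0|[u uA]] := set_0Vmem (core i).
  by rewrite A0 big_set0 addr_ge0 // invr_ge0 ltW.
have u_iso : nonisolated e u by move: uA; rewrite inE => /andP[].
have [_ _ _ /(_ u u_iso)] := e_dense.
have : \sum_(v | e u v) w v + \sum_(v in core i) w v + \sum_(v | pred0 v) w v <=
    \sum_(v | predT v) w v.
  apply: sum_packing => // v /=; have [vA|//] := boolP (v \in core i).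
    by rewrite (negPf (core_independent uA vA)).
  by case: (e u v).
by rewrite sum_w big_pred0_eq; lra.
Qed.

(** The cores and [off_core] carry the total weight 1, and the other [r - 1] cores have at most
    [1/r + d] each. *)
Lemma weight_core_ge i : r%:R^-1 - rho - r%:R * d <= \sum_(v in core i) w v.
Proof.
have [_ _ w_iso _] := e_dense.
have : 1 <= \sum_(j < r) \sum_(v in core j) w v + rho.
  rewrite -sum_w /rho; under [X in _ <= X + _]eq_bigr do rewrite big_mkcond.
  rewrite [X in _ <= X + _]exchange_big [\sum_(v in off_core) _]big_mkcond -big_split ler_sum //= => v _.
  have s_ge0 : 0 <= \sum_(j < r) (if v \in core j then w v else 0).
    by apply: sumr_ge0 => j _; case: ifP.
  have [v_iso|v_iso] := boolP (nonisolated e v); last first.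
    by rewrite w_iso // big1 ?if_same ?addr0 // => j _; rewrite if_same.
  have [_|] := boolP (v \in off_core); first by rewrite lerDr.
  rewrite inE v_iso negb_forall /= => /existsP[j]; rewrite negbK => vj.
  rewrite addr0 (bigD1 j) //= vj lerDl.
  by apply: sumr_ge0 => ? _; case: ifP.
rewrite (bigD1 i) //=.
have : \sum_(j < r | j != i) \sum_(v in core j) w v <= (r%:R - 1) * (r%:R^-1 + d).
  apply: le_trans (_ : \sum_(j < r | j != i) (r%:R^-1 + d) <= _).
    by apply: ler_sum => j _; apply: weight_core_le.
  by rewrite sumr_const cardC1 card_ord -[leLHS]mulr_natl -subn1 natrB.
have rV : r%:R * r%:R^-1 = 1 :> R by rewrite divff // pnatr_eq0 -lt0n.
have d0 := d_ge0.
by rewrite mulrDr mulrBl rV; nra.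
Qed.

(** The non-neighbours of [u] weigh at most [1/r + d], and the core of [u] already uses up nearly
    all of that. *)
Lemma core_miss i j u : i != j -> u \in core i ->
  \sum_(v in core j | ~~ e u v) w v <= k.
Proof.
move=> ij uA; have u_iso : nonisolated e u by move: uA; rewrite inE => /andP[].
have [_ _ _ /(_ u u_iso)] := e_dense; have := weight_core_ge i.
have : \sum_(v | e u v) w v + \sum_(v in core i) w v +
    \sum_(v | (v \in core j) && ~~ e u v) w v <= \sum_(v | predT v) w v.
  apply: sum_packing => // v /=; case: (boolP (v \in core i)) => [vA|_].
    rewrite (negPf (core_independent uA vA)) andbT.
    by case vj: (v \in core j) => //; rewrite (core_disjoint vA vj) eqxx in ij.
  by case: (e u v); case: (v \in core j).
by rewrite sum_w /k; nra.
Qed.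

(** Otherwise the neighbours of [v] in the cores leave room to embed F with [v] as a hub. *)
Lemma exists_class v : exists i, \sum_(z in core i | e v z) w z <= eta.
Proof.
apply/existsP; apply: contraT; rewrite negb_exists => /forallP large.
pose C i := [set z in core i | e v z].
have CR : roomy VF e C w d k.
  split=> //; first exact: le_trans le_dk.
  - by case: e_dense.
  - move=> i j u ij; rewrite inE => /andP[uA _]; apply: le_trans (core_miss ij uA).
    rewrite [leLHS]big_mkcond [leRHS]big_mkcond ler_sum // => z _; rewrite [z \in C j]inE.
    by case: (z \in core j) => //=; case: (e v z); case: (e u z) => //=; rewrite w_ge0.
  move=> i; have := large i; rewrite -ltNge; congr (_ < _).
  by apply: eq_bigl => z; rewrite [RHS]inE.
case: (critical_hub i0 (v := v) sym_e symF irrF xyF Ffree CR irr_e).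
by move=> j z; rewrite inE => /andP[].
Qed.

Lemma class_miss i j v : nonisolated e v -> \sum_(z in core i | e v z) w z <= eta ->
  j != i -> \sum_(z in core j | ~~ e v z) w z <= k + eta.
Proof.
move=> v_iso v_class ji; have [_ _ _ /(_ v v_iso)] := e_dense; have := weight_core_ge i.
have : \sum_(z | e v z) w z + \sum_(z | (z \in core j) && ~~ e v z) w z +
    \sum_(z | (z \in core i) && ~~ e v z) w z <= \sum_(z | predT z) w z.
  apply: sum_packing => // z /=; case: (e v z); rewrite ?andbF // !andbT.
  have [zi|_] := boolP (z \in core i); last by case: (z \in core j).
  by case zj: (z \in core j) => //; rewrite (core_disjoint zi zj) eqxx in ji.
rewrite sum_w (bigID (e v) (mem (core i))) /= /k; lra.
Qed.

(** Each vertex gets a class given by [exists_class]. For an edge [u v] inside class [i], the sets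
    [C] of common neighbours in the other cores would be roomy, against [critical_edge]. *)
Lemma partite_of_small : k * (3 * (2 * #|VF|%:R + 1) * r%:R) < 1 ->
  exists p : V -> 'I_r, forall u v, e u v -> p u != p v.
Proof.
move=> k_small.
have d0 := d_ge0; have k_ge0 : 0 <= k by exact: le_trans le_dk.
have n_ge0 : 0 <= #|VF|%:R :> R by [].
have eta_ge0 : 0 <= eta by rewrite mulr_ge0 // addr_ge0.
(* A core weighs at least [1/r - k], loses at most [2 * (k + eta)] in passing to [C], and must keep
   more than [eta]. *)
have eta_le : 3 * k + 3 * eta < r%:R^-1.
  rewrite -[ltRHS]mul1r ltr_pdivlMr //; apply: le_lt_trans k_small.
  rewrite mulrA ler_pM2r // /eta; have := le_dk; nra.
have [p pP] := fin_all_exists exists_class.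
exists p => u v euv; apply: contraL euv => /eqP puv.
have [u_iso|/existsPn/(_ v)//] := boolP (nonisolated e u).
have [v_iso|/existsPn/(_ u)] := boolP (nonisolated e v); last by rewrite sym_e.
pose i := p u.
pose C j := if j == i then core i :\: [set u; v] else [set z in core j | e u z && e v z].
have sC j : C j \subset core j.
  rewrite /C; have [->|_] := eqVneq j i; first exact: subsetDl.
  by apply/subsetP => z; rewrite inE => /andP[].
have CR : roomy VF e C w d k.
  split=> //; first by case: e_dense.
  - move=> j l z jl /(subsetP (sC j)) zA; apply: le_trans (core_miss jl zA).
    rewrite [leLHS]big_mkcond [leRHS]big_mkcond ler_sum // => z' _.
    have [/(subsetP (sC l))-> //|_] := boolP (z' \in C l).
    by case: ifP.
  move=> j; apply: (@le_lt_trans _ _ eta) => //; rewrite /C.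
  have wj := weight_core_ge j; have := rho_ge0; rewrite -/rho in wj.
  have [ji|ji] := eqVneq j i.
    have : \sum_(z in core j) w z <= \sum_(z in core j :\: [set u; v]) w z +
        \sum_(z | z == u) w z + \sum_(z | z == v) w z.
      apply: sum_covering => // z; rewrite in_setD in_set2.
      by case: (z == u); case: (z == v); case: (z \in core j).
    rewrite !big_pred1_eq; have [_ w_d _ _] := e_dense.
    by have /andP[_] := w_d u; have /andP[_] := w_d v; rewrite -ji; move: wj eta_le le_dk; rewrite /k; lra.
  have : \sum_(z in core j) w z <= \sum_(z in [set z in core j | e u z && e v z]) w z +
      \sum_(z | (z \in core j) && ~~ e u z) w z + \sum_(z | (z \in core j) && ~~ e v z) w z.
    apply: sum_covering => // z; rewrite [z \in [set _ | _]]inE.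
    by case: (z \in core j) => //; case: (e u z); case: (e v z).
  have := class_miss u_iso (pP u) ji; have := class_miss v_iso (pP v); rewrite -puv.
  move=> /(_ j ji); move: wj eta_le le_dk; rewrite /k; lra.
apply: (critical_edge (i := i) sym_e symF irrF xyF Ffree CR _ _ _ irr_e).
- by move=> j z ji; rewrite /C (negPf ji) inE => /and3P[].
- by rewrite /C eqxx !inE eqxx.
by rewrite /C eqxx !inE eqxx orbT.
Qed.

End ApproximatePartition.

Lemma dense_partite (VF : finType) (eF : rel VF) (r : nat) (x y : VF) :
  symmetric eF -> irreflexive eF -> critical_pair eF r x y -> (0 < r)%N ->
  exists N : nat,
  forall (R : realFieldType) (V : finType) (e : rel V) (w : V -> R) (d : R),
    symmetric e -> irreflexive e -> F_free e eF -> dense_weight e w r d ->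
    d * N%:R <= 1 -> exists p : V -> 'I_r, forall u v, e u v -> p u != p v.
Proof.
move=> symF irrF xyF r_gt0; pose n := #|VF|.
(* The goal will be [3 * m * k < 1], where [k <= 4n/t + (5r + 1)d]. The choice of [t] makes the
   first term contribute less than 1/4, and the second summand of [N] makes the other contribute at
   most 1/4. *)
pose m := ((2 * n + 1) * r)%N; pose t := (48 * n.+1 * m)%N.
have m_gt0 : (0 < m)%N by rewrite muln_gt0 addn1.
have [N0 N0P] := @complete_parts_exist r r t (leqnn r).
exists (N0 + 12 * m * (5 * r + 1))%N => R V e w d sym_e irr_e Ffree e_dense d_small.
have d_ge0 := dense_weight_ge0 e_dense.
have small k : (k <= N0 + 12 * m * (5 * r + 1))%N -> d * k%:R <= 1.
  by move=> le_k; apply: le_trans d_small; rewrite ler_wpM2l // ler_nat.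
have [|B BP] := N0P R V e w d sym_e e_dense; first by rewrite small ?leq_addr.
have t_large : (4 * (#|VF| + 3) <= t)%N by rewrite /t -/n; nia.
apply: (partite_of_small sym_e irr_e e_dense symF irrF xyF Ffree BP r_gt0 t_large).
have := weight_off_core sym_e irr_e e_dense symF irrF xyF Ffree BP r_gt0.
set rho := \sum_(v in _) _ => rho_le.
have {small} dm : d * (12 * m%:R * (5 * r%:R + 1)) <= 1.
  by have := small _ (leq_addl N0 _); rewrite !(natrM, natrD).
have mE : m%:R = (2 * n%:R + 1) * r%:R :> R by rewrite !(natrM, natrD).
have tE : t%:R = 48 * (n%:R + 1) * m%:R :> R by rewrite !natrM -[n.+1%:R]natr1.
have m0 : 0 < m%:R :> R by rewrite ltr0n.
have n0 : 0 <= n%:R :> R by [].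
have t0 : 0 < t%:R :> R by rewrite tE !mulr_gt0 // ltr_wpDl.
have -> : 3 * (2 * #|VF|%:R + 1) * r%:R = 3 * m%:R :> R by rewrite mE mulrA.
rewrite -(ltr_pM2l t0) mulr1.
have : t%:R * rho * (3 * m%:R) <= 4 * (n%:R + r%:R * t%:R * d) * (3 * m%:R).
  by rewrite ler_pM2r ?mulr_gt0.
have : t%:R * (d * (12 * m%:R * (5 * r%:R + 1))) <= t%:R * 1 by rewrite ler_pM2l.
have : 48 * (n%:R * m%:R) <= t%:R - 48 * m%:R :> R by rewrite tE; lra.
lra.
Qed.

(** * Weights of neighbourhoods and of bounded sets *)

Lemma card_arcs (V : finType) (e : rel V) : symmetric e -> irreflexive e ->
  #|[set p : V * V | e p.1 p.2]| = (2 * #|edges e|)%N.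
Proof.
move=> sym_e irr_e; rewrite -sum1_card.
rewrite (partition_big (fun p => [set p.1; p.2]) (mem (edges e))) /=; last first.
  by move=> p pe; apply/imsetP; exists p.
rewrite (eq_bigr (fun=> 2%N)) ?sum_nat_const 1?mulnC // => P /imsetP[[a b]].
rewrite inE /= => eab ->; have ab : a != b by apply: contraTneq eab => ->; rewrite irr_e.
rewrite sum1dep_card -[RHS](_ : #|[set (a, b); (b, a)]| = 2%N); last first.
  by rewrite cards2 xpair_eqE negb_and ab.
apply: eq_card => -[c d]; rewrite !inE /= !xpair_eqE.
apply/andP/orP => [[ecd /eqP S]|[]/andP[/eqP-> /eqP->]]; last 2 first.
- by rewrite eab eqxx.
- by rewrite sym_e eab setUC eqxx.
have cd : c != d by apply: contraTneq ecd => ->; rewrite irr_e.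
have : c \in [set a; b] by rewrite -S set21.
have : d \in [set a; b] by rewrite -S set22.
rewrite !inE => /orP[]/eqP dE /orP[]/eqP cE; subst; rewrite ?eqxx in cd *; by [|left|right].
Qed.

Section Arcs.
Variables (R : rcfType) (V : finType).
Implicit Types (e : rel V) (x : V -> R).

Definition arcs e : R := \sum_u \sum_v (e u v)%:R.
Definition deg e u : R := \sum_v (e u v)%:R.

Lemma arcs_edges e : symmetric e -> irreflexive e -> arcs e = (2 * #|edges e|)%:R.
Proof.
move=> sym_e irr_e; rewrite -card_arcs // /arcs pair_big /= -sum1_card natr_sum.
rewrite [RHS]big_mkcond; apply: eq_bigr => p _.
by rewrite inE; case: (e _ _).
Qed.

Lemma arcs_ge0 e : 0 <= arcs e.
Proof. by apply: sumr_ge0 => u _; apply: sumr_ge0 => v _; apply: ler0n. Qed.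

Lemma eq_arcs e1 e2 : e1 =2 e2 -> arcs e1 = arcs e2.
Proof. by move=> e12; apply: eq_bigr => u _; apply: eq_bigr => v _; rewrite e12. Qed.

Lemma deg_ge0 e u : 0 <= deg e u.
Proof. by apply: sumr_ge0 => v _; apply: ler0n. Qed.

Lemma degE e u : deg e u = #|[set v | e u v]|%:R.
Proof.
rewrite -sum1_card natr_sum [RHS]big_mkcond; apply: eq_bigr => v _.
by rewrite inE; case: (e u v).
Qed.

Lemma deg_gt0 e u : nonisolated e u -> 0 < deg e u.
Proof.
by case/existsP=> v euv; rewrite degE ltr0n card_gt0; apply/set0Pn; exists v; rewrite inE.
Qed.

Definition perron e x := [/\ forall u, 0 <= x u, \sum_u x u ^+ 2 = 1 &
    forall u, spec_rad e R * x u = \sum_v (e u v)%:R * x v].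

Lemma perron_isolated e x u : 0 < spec_rad e R -> perron e x ->
  ~~ nonisolated e u -> x u = 0.
Proof.
move=> l_gt0 [_ _ xE] /existsPn u_iso; have /eqP := xE u.
rewrite big1 => [|v _]; last by rewrite (negPf (u_iso v)) mul0r.
by rewrite mulf_eq0 gt_eqF //= => /eqP.
Qed.

Lemma perron_quad e x : perron e x ->
  spec_rad e R = \sum_u \sum_v (e u v)%:R * (x u * x v).
Proof.
case=> _ x1 xE; transitivity (spec_rad e R * \sum_u x u ^+ 2).
  by rewrite x1 mulr1.
rewrite mulr_sumr; apply: eq_bigr => u _.
by rewrite expr2 mulrCA xE mulr_sumr; apply: eq_bigr => v _; rewrite mulrCA.
Qed.

(** Cauchy-Schwarz for the eigenvalue equation at [u], in the form of a nonnegative sum of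
    squares. *)
Lemma perron_neighborhood e x u : perron e x ->
  spec_rad e R ^+ 2 * x u ^+ 2 <= deg e u * \sum_(v | e u v) x v ^+ 2.
Proof.
case=> x_ge0 _ xE; rewrite -exprMn xE; set D := deg e u.
have D_ge0 : 0 <= D by apply: deg_ge0.
set S := \sum_v _; set Q := \sum_(v | _) _.
have : 0 <= \sum_v (e u v)%:R * (x v * D - S) ^+ 2.
  by apply: sumr_ge0 => v _; rewrite mulr_ge0 ?sqr_ge0.
have -> : \sum_v (e u v)%:R * (x v * D - S) ^+ 2 = D * (D * Q - S ^+ 2).
  rewrite (eq_bigr (fun v => D ^+ 2 * ((e u v)%:R * x v ^+ 2) +
     (- (2 * D * S)) * ((e u v)%:R * x v) + S ^+ 2 * (e u v)%:R)); last by move=> v _; ring.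
  rewrite !big_split -!mulr_sumr /= -/S -/(deg e u) -/D.
  have -> : \sum_v (e u v)%:R * x v ^+ 2 = Q.
    by rewrite /Q [RHS]big_mkcond; apply: eq_bigr => v _; case: (e u v); rewrite ?mul1r ?mul0r.
  ring.
have [D0|D_neq0] := eqVneq D 0; last by rewrite pmulr_rge0 ?subr_ge0 // lt_def D_neq0.
move=> _; have /psumr_eq0P e0 : D = 0 by [].
by rewrite D0 mul0r /S big1 ?expr0n // => v _; rewrite e0 ?mul0r // => ? _; apply: ler0n.
Qed.

(** Summing the eigenvalue equation over [S] and over its complement and subtracting cancels the
    crossing arcs; the arcs inside the complement contribute nonnegatively. *)
Lemma perron_inner_arcs e x (S : {set V}) : symmetric e -> perron e x ->
  spec_rad e R * (2 * (\sum_(u in S) x u ^+ 2) - 1) <=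
    \sum_(u in S) \sum_(v in S) (e u v)%:R * (x u * x v).
Proof.
move=> sym_e [x_ge0 x1 xE]; set l := spec_rad e R.
pose I (A B : pred V) := \sum_(u | A u) \sum_(v | B v) (e u v)%:R * (x u * x v).
have lI (A : pred V) : l * \sum_(u | A u) x u ^+ 2 = I A (mem S) + I A (predC (mem S)).
  rewrite mulr_sumr -big_split; apply: eq_bigr => u _ /=.
  rewrite expr2 mulrCA xE mulr_sumr (bigID (mem S)) /=.
  by congr (_ + _); apply: eq_bigr => v _; rewrite mulrCA.
have I_ge0 (A B : pred V) : 0 <= I A B.
  by apply: sumr_ge0 => u _; apply: sumr_ge0 => v _; rewrite !mulr_ge0.
have IC (A B : pred V) : I A B = I B A.
  rewrite /I exchange_big; apply: eq_bigr => u _; apply: eq_bigr => v _.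
  by rewrite sym_e [x v * _]mulrC.
set W := \sum_(u in S) x u ^+ 2.
have WC : \sum_(u | predC (mem S) u) x u ^+ 2 = 1 - W.
  by have := x1; rewrite (bigID (mem S)) /= addrC => /(canRL (addrK _)).
have := lI (mem S); have := lI (predC (mem S)); rewrite WC -/W -/(I (mem S) (mem S)).
have := I_ge0 (predC (mem S)) (predC (mem S)); rewrite (IC (mem S) (predC _)).
lra.
Qed.

Lemma perron_sqr_le_half e x u : symmetric e -> irreflexive e -> 0 < spec_rad e R ->
  perron e x -> 2 * x u ^+ 2 <= 1.
Proof.
move=> sym_e irr_e l_gt0 xP; have := perron_inner_arcs [set u] sym_e xP.
by rewrite !big_set1 irr_e mul0r pmulr_rle0 // subr_le0.
Qed.

(** The inner arcs contribute at most [#|S|] by AM-GM, so a bounded set weighs little more than 1/2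
    when the spectral radius is large. *)
Lemma heavy_set e x (S : {set V}) : symmetric e -> perron e x ->
  spec_rad e R * (2 * (\sum_(u in S) x u ^+ 2) - 1) <= #|S|%:R.
Proof.
move=> sym_e xP; apply: le_trans (perron_inner_arcs S sym_e xP) _.
case: xP => x_ge0 x1 _; set W := \sum_(u in S) x u ^+ 2.
have W_le1 : W <= 1.
  rewrite -x1 [leRHS](bigID (mem S)) /= lerDl.
  by apply: sumr_ge0 => u _; apply: sqr_ge0.
suff: \sum_(u in S) \sum_(v in S) (e u v)%:R * (x u * x v) <= #|S|%:R * W.
  by move=> /le_trans; apply; rewrite ler_piMr.
have -> : #|S|%:R * W = \sum_(u in S) \sum_(v in S) (x u ^+ 2 / 2 + x v ^+ 2 / 2).
  under eq_bigr do rewrite big_split sumr_const -[_ *+ _]mulr_natr /=.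
  rewrite big_split sumr_const -[_ *+ _]mulr_natr /= -!mulr_suml -/W; lra.
apply: ler_sum => u _; apply: ler_sum => v _.
have := mulr_ge0 (x_ge0 u) (x_ge0 v); have := sqr_ge0 (x u - x v).
by case: (e u v); rewrite ?mul1r ?mul0r; lra.
Qed.

End Arcs.

(** * Spectral radius of r-partite graphs *)

Lemma psumr_eq0_all (R : numDomainType) (I : finType) (F : I -> R) :
  (forall i, 0 <= F i) -> \sum_i F i = 0 -> forall i, F i = 0.
Proof. by move=> F_ge0 /psumr_eq0P F0 i; apply: F0. Qed.

Section Partite.
Variables (R : rcfType) (V : finType) (e : rel V) (r : nat) (p : V -> 'I_r) (x : V -> R).
Hypotheses (sym_e : symmetric e) (irr_e : irreflexive e).
Hypotheses (l_gt0 : 0 < spec_rad e R) (xP : perron e x).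
Hypothesis (p_proper : forall u v, e u v -> p u != p v).

Let l := spec_rad e R.
Let D := arcs R e.
Let w u := x u ^+ 2.
(** Three nonnegative defects follow: [Z] for missing pairs across classes, [Y] for unequal class
    weights, [Cs] for Cauchy-Schwarz over the arcs. *)
Let Q := \sum_u \sum_v (e u v)%:R * (w u * w v).
Let Z := \sum_u \sum_v ((p u != p v) && ~~ e u v)%:R * (w u * w v).
Let W i := \sum_(u | p u == i) w u.
Let Y := \sum_i (W i - r%:R^-1) ^+ 2.
Let Cs := \sum_u \sum_v (e u v)%:R * (x u * x v * D - l) ^+ 2.

Let r_neq0 : r%:R != 0 :> R.
Proof.
have [_ x1 _] := xP; rewrite pnatr_eq0 -lt0n; case: (posnP r) => // r0.
suff V0 : \sum_u x u ^+ 2 = 0 by move/eqP: x1; rewrite V0 eq_sym oner_eq0.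
by apply: big1 => u _; case: (p u) => i; rewrite r0.
Qed.

(** All pairs have total weight 1; pairs inside classes contribute the sum of the [W i ^+ 2], which
    is [1/r + Y]. *)
Lemma partite_weight : Q = 1 - r%:R^-1 - Z - Y.
Proof.
have [_ x1 _] := xP.
have W1 : \sum_i W i = 1.
  by rewrite -[RHS]x1 (partition_big p predT).
have YE : Y = \sum_i W i ^+ 2 - r%:R^-1.
  rewrite /Y (eq_bigr (fun i => W i ^+ 2 + (- (2 * r%:R^-1)) * W i + r%:R^-1 ^+ 2)); last first.
    by move=> i _; ring.
  rewrite !big_split -mulr_sumr /= W1 sumr_const card_ord -[_ ^+ 2 *+ r]mulr_natl.
  have -> : r%:R * r%:R^-1 ^+ 2 = r%:R^-1 :> R by rewrite expr2 mulrA divff // mul1r.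
  ring.
have WE : \sum_i W i ^+ 2 = \sum_u \sum_v (p u == p v)%:R * (w u * w v).
  rewrite [RHS](partition_big p predT) //=; apply: eq_bigr => i _.
  rewrite expr2 mulr_suml; apply: eq_bigr => u /eqP pu.
  rewrite mulr_sumr [LHS]big_mkcond; apply: eq_bigr => v _.
  by rewrite pu [i == _]eq_sym; case: eqP; rewrite ?mul1r ?mul0r.
have : \sum_u \sum_v w u * w v = 1.
  by under eq_bigr do rewrite -mulr_sumr x1 mulr1; rewrite x1.
suff -> : \sum_u \sum_v w u * w v = Q + Z + \sum_i W i ^+ 2 by rewrite YE; lra.
rewrite WE -!big_split; apply: eq_bigr => u _; rewrite -!big_split; apply: eq_bigr => v _ /=.
by have := @p_proper u v; case: (e u v); case: eqP => //= _ H; rewrite ?mul1r ?mul0r ?addr0 ?add0r //; have := H isT.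
Qed.

Lemma partite_cauchy : Cs = D * (D * Q - l ^+ 2).
Proof.
have lE := perron_quad xP; rewrite -/l in lE.
transitivity (\sum_u \sum_v (D ^+ 2 * ((e u v)%:R * (w u * w v)) +
    (- (2 * D * l)) * ((e u v)%:R * (x u * x v)) + l ^+ 2 * (e u v)%:R)).
  by apply: eq_bigr => u _; apply: eq_bigr => v _; rewrite /w; ring.
under eq_bigr do rewrite !big_split -!mulr_sumr /=.
by rewrite !big_split -!mulr_sumr /= -lE -/Q -/(arcs R e) -/D; ring.
Qed.

Let ww_ge0 (b : bool) u v : 0 <= b%:R * (w u * w v).
Proof. by apply: mulr_ge0; [exact: ler0n | apply: mulr_ge0; exact: sqr_ge0]. Qed.
Let sq_ge0 (b : bool) (y : R) : 0 <= b%:R * y ^+ 2.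
Proof. by apply: mulr_ge0; [exact: ler0n | exact: sqr_ge0]. Qed.
Let Z_ge0 : 0 <= Z.
Proof. by apply: sumr_ge0 => u _; apply: sumr_ge0 => v _; apply: ww_ge0. Qed.
Let Y_ge0 : 0 <= Y. Proof. by apply: sumr_ge0 => i _; apply: sqr_ge0. Qed.
Let Cs_ge0 : 0 <= Cs.
Proof. by apply: sumr_ge0 => u _; apply: sumr_ge0 => v _; apply: sq_ge0. Qed.

Lemma partite_arcs_gt0 : 0 < D.
Proof.
rewrite lt_def arcs_ge0 andbT; apply/eqP => D0; move: l_gt0.
have e0 u v : (e u v)%:R = 0 :> R.
  have /psumr_eq0P/(_ u isT) : D = 0 by [].
  move=> /(_ (fun u _ => deg_ge0 R e u))/psumr_eq0P; apply=> // ? _; exact: ler0n.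
rewrite (perron_quad xP) big1 ?ltxx // => u _; rewrite big1 // => v _.
by rewrite e0 mul0r.
Qed.

Lemma partite_spec_rad_le : l ^+ 2 <= (1 - r%:R^-1) * D.
Proof.
have D0 := partite_arcs_gt0; have := Cs_ge0.
rewrite partite_cauchy pmulr_rge0 // partite_weight; have := Z_ge0; have := Y_ge0; nra.
Qed.

(** Equality makes the three defects vanish: [Z] gives completeness, [Y] equal class weights, and
    [Cs] a constant product [x u * x v] over the edges. *)
Lemma partite_spec_rad_eq : (3 <= r)%N -> l ^+ 2 = (1 - r%:R^-1) * D ->
  regular_complete_partite e r.
Proof.
move=> r_ge3 l_eq; have D0 := partite_arcs_gt0; have CsE := partite_cauchy.
have [Z0 Y0 C0] : [/\ Z = 0, Y = 0 & Cs = 0].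
  have Y0 := Y_ge0; have Z0 := Z_ge0; have C0 := Cs_ge0.
  have CE : Cs = D * (- (D * (Z + Y))) by rewrite CsE partite_weight l_eq; ring.
  have : D * (Z + Y) <= 0 by rewrite -oppr_ge0 -(pmulr_rge0 _ D0) -CE.
  rewrite pmulr_rle0 // => ZY0.
  have {ZY0} [Z1 Y1] : Z = 0 /\ Y = 0 by split; lra.
  by split=> //; rewrite CE Z1 Y1; ring.
have xx u v : e u v -> x u * x v * D = l.
  move=> euv; apply/eqP; rewrite -subr_eq0 -sqrf_eq0.
  have C0u : \sum_v (e u v)%:R * (x u * x v * D - l) ^+ 2 = 0.
    by apply: (psumr_eq0_all _ C0) => u'; apply: sumr_ge0 => v' _; apply: sq_ge0.
  have := psumr_eq0_all (fun v' => sq_ge0 _ _) C0u v.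
  by rewrite euv mul1r => ->.
have x_neq0 u : nonisolated e u -> x u != 0.
  case/existsP=> v /xx; apply: contra_eq_neq => ->; rewrite !mul0r.
  by rewrite lt_eqF.
have complete u v : nonisolated e u -> nonisolated e v -> e u v = (p u != p v).
  move=> u_iso v_iso; apply/idP/idP; first exact: p_proper.
  move=> puv; apply: contraT => euv.
  have Z0u : \sum_v ((p u != p v) && ~~ e u v)%:R * (w u * w v) = 0.
    by apply: (psumr_eq0_all _ Z0) => u'; apply: sumr_ge0 => v' _; apply: ww_ge0.
  have /eqP := psumr_eq0_all (fun v' => ww_ge0 _ _ _) Z0u v.
  rewrite puv euv mul1r mulf_eq0 !sqrf_eq0 (negPf (x_neq0 _ u_iso)).
  by rewrite (negPf (x_neq0 _ v_iso)).
have Wr i : W i = r%:R^-1.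
  apply/eqP; rewrite -subr_eq0 -sqrf_eq0.
  by rewrite (psumr_eq0_all (fun i => sqr_ge0 _) Y0).
have part_iso i : exists2 z, nonisolated e z & p z = i.
  have [/exists_inP[z z_iso /eqP pz]|] := boolP [exists (z | nonisolated e z), p z == i].
    by exists z.
  rewrite negb_exists_in => /forall_inP all_iso; move/eqP: (Wr i).
  rewrite /W big1 => [|u pu]; first by rewrite eq_sym invr_eq0 (negPf r_neq0).
  rewrite /w (perron_isolated l_gt0 xP) ?expr0n //.
  by apply: contraL pu => /all_iso.
(* As [r >= 3], some class avoids both [u] and [v] and contains a common neighbour [z]. Once [x] is
   constant, equal class weights mean equal sizes. *)
have x_const u v : nonisolated e u -> nonisolated e v -> x u = x v.
  move=> u_iso v_iso.
  have [i iP] : exists i : 'I_r, i \notin [:: p u; p v].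
    apply/existsP; apply: contraT; rewrite negb_exists => /forallP all_in.
    have : (size (enum 'I_r) <= 2)%N.
      apply: (@uniq_leq_size _ _ [:: p u; p v]) => [|i _]; first exact: enum_uniq.
      by have := all_in i; rewrite negbK.
    by rewrite size_enum_ord leqNgt r_ge3.
  have [z z_iso pz] := part_iso i; move: iP; rewrite !inE negb_or -pz => /andP[zu zv].
  have ezu : e z u by rewrite complete.
  have ezv : e z v by rewrite complete.
  have := xx _ _ ezu; rewrite -(xx _ _ ezv) => /(mulIf _) -/(_ (lt0r_neq0 D0)).
  by move/(mulfI (x_neq0 _ z_iso)).
exists p; split=> // i j.
have [z z_iso _] := part_iso i.
have cardW k : W k = #|[set u | nonisolated e u & p u == k]|%:R * w z.
  rewrite mulr_natl -sumr_const /W (bigID (nonisolated e)) /= [X in _ + X]big1 ?addr0.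
    apply: eq_big => [u|u /andP[_ u_iso]]; first by rewrite inE andbC.
    by rewrite /w (x_const u z).
  by move=> u /andP[_ u_iso]; rewrite /w (perron_isolated l_gt0 xP) // expr0n.
have w_neq0 : w z != 0 by rewrite sqrf_eq0 x_neq0.
have := cardW j; rewrite Wr -(Wr i) cardW => /(mulIf w_neq0)/eqP.
by rewrite eqr_nat => /eqP.
Qed.

End Partite.

(** All non-isolated degrees equal [d = (r - 1)t]. The indicator of the non-isolated vertices gives
    [d <= l], and AM-GM on the Perron vector gives [l <= d]. *)
Lemma spec_rad_regular_complete_partite (R : rcfType) (V : finType) (e : rel V) r :
  symmetric e -> irreflexive e -> (0 < r)%N -> 0 < arcs R e ->
  regular_complete_partite e r ->
  spec_rad e R ^+ 2 = (1 - r%:R^-1) * arcs R e.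
Proof.
move=> sym_e irr_e r_gt0 D_gt0 [p [complete sizes]].
pose t := #|[set u | nonisolated e u & p u == Ordinal r_gt0]|.
have {}sizes i : #|[set u | nonisolated e u & p u == i]| = t by apply: sizes.
pose n := #|[set u | nonisolated e u]|.
have nE : n = (r * t)%N.
  rewrite /n -sum1_card (partition_big p predT) //=.
  rewrite (eq_bigr (fun=> t)) ?sum_nat_const ?card_ord // => i _.
  by rewrite sum1dep_card -(sizes i); apply: eq_card => u; rewrite !inE.
have degE u : nonisolated e u -> deg R e u = (r%:R - 1) * t%:R.
  move=> u_iso; rewrite degE mulrBl mul1r -natrM -nE -(sizes (p u)) /n.
  have -> : [set v | e u v] = [set v | nonisolated e v] :\: [set v | nonisolated e v & p v == p u].
    apply/setP => v; rewrite !inE; have [v_iso|v_iso] := boolP (nonisolated e v).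
      by rewrite complete // andbT eq_sym.
    by rewrite andbF; apply: contraNF v_iso => euv; apply/existsP; exists u; rewrite sym_e.
  rewrite cardsD natrB ?subset_leq_card ?subsetIl //.
  by congr (_ - _%:R); apply: eq_card => v; rewrite !inE andbA andbb.
have DE : arcs R e = n%:R * ((r%:R - 1) * t%:R).
  rewrite /arcs (bigID (nonisolated e)) /= [X in _ + X]big1 ?addr0; last first.
    move=> u /existsPn u_iso; apply: big1 => v _; by rewrite (negPf (u_iso v)).
  rewrite (eq_bigr (fun=> (r%:R - 1) * t%:R)) => [|u /degE //].
  by rewrite sumr_const mulr_natl /n cardsE.
set l := spec_rad e R; pose d : R := (r%:R - 1) * t%:R.
have n_gt0 : 0 < n%:R :> R.
  rewrite ltr0n lt0n; apply: contraTneq D_gt0 => n0; rewrite DE n0 mul0r ltxx //.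
have d_gt0 : 0 < d by move: D_gt0; rewrite DE pmulr_rgt0.
have le_dl : d <= l.
  have := le_spec_rad (fun u => (nonisolated e u)%:R : R) sym_e.
  have -> : \sum_u (nonisolated e u)%:R ^+ 2 = n%:R :> R.
    rewrite /n -sum1_card natr_sum [RHS]big_mkcond; apply: eq_bigr => u _.
    by rewrite inE; case: (nonisolated e u); rewrite ?expr1n ?expr0n.
  have -> : \sum_u \sum_v (e u v)%:R * ((nonisolated e u)%:R * (nonisolated e v)%:R) = arcs R e.
    apply: eq_bigr => u _; apply: eq_bigr => v _; case euv: (e u v); last by rewrite mul0r.
    have -> : nonisolated e u by apply/existsP; exists v.
    have -> : nonisolated e v by apply/existsP; exists u; rewrite sym_e.
    by rewrite !mulr1.
  by rewrite DE [n%:R * _]mulrC ler_pM2r.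
have l_gt0 : 0 < l by apply: lt_le_trans le_dl.
have [x xP] := perron_vector sym_e l_gt0.
have le_ld : l <= d.
  have [_ x1 _] := xP.
  have -> : d = \sum_u d * x u ^+ 2 by rewrite -mulr_sumr x1 mulr1.
  apply: (@le_trans _ _ (\sum_u deg R e u * x u ^+ 2)); last first.
    apply: ler_sum => u _; have [u_iso|u_iso] := boolP (nonisolated e u).
      by rewrite degE.
    by rewrite (perron_isolated l_gt0 xP u_iso) expr0n !mulr0.
  rewrite /l (perron_quad xP).
  have -> : \sum_u deg R e u * x u ^+ 2 =
      \sum_u \sum_v (e u v)%:R * (x u ^+ 2 / 2 + x v ^+ 2 / 2).
    have S : \sum_u \sum_v (e u v)%:R * (x v ^+ 2 / 2) = \sum_u \sum_v (e u v)%:R * (x u ^+ 2 / 2).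
      by rewrite exchange_big; apply: eq_bigr => u _; apply: eq_bigr => v _; rewrite sym_e.
    under [RHS]eq_bigr do (under eq_bigr do rewrite mulrDr; rewrite big_split /=).
    rewrite big_split /= S -big_split; apply: eq_bigr => u _ /=.
    by rewrite -mulr_suml -/(deg R e u); lra.
  apply: ler_sum => u _; apply: ler_sum => v _; rewrite ler_wpM2l //.
  by have := sqr_ge0 (x u - x v); lra.
have -> : l = d by apply/le_anti/andP.
have rn0 : r%:R != 0 :> R by rewrite pnatr_eq0 -lt0n.
by rewrite DE nE natrM /d; field.
Qed.

(** * Optimal induced subgraphs *)

Section InducedSubgraph.
Variables (R : rcfType) (V : finType).
Implicit Types (e : rel V) (U : {set V}) (x : V -> R).

(** The vertex type is kept: vertices outside [U] merely become isolated. *)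
Definition induced e U : rel V := fun u v => [&& u \in U, v \in U & e u v].

Lemma induced_sym e U : symmetric e -> symmetric (induced e U).
Proof. by move=> sym_e u v; rewrite /induced sym_e andbCA. Qed.

Lemma induced_irr e U : irreflexive e -> irreflexive (induced e U).
Proof. by move=> irr_e u; rewrite /induced irr_e !andbF. Qed.

Lemma inducedT e : induced e [set: V] =2 e.
Proof. by move=> u v; rewrite /induced !inE. Qed.

Lemma induced_setD1 e U v : induced e (U :\ v) =2 induced (induced e U) [set~ v].
Proof.
by move=> a b; rewrite /induced !inE; case: (a == v); case: (b == v); case: (a \in U); rewrite ?andbF.
Qed.

Lemma arcs_delete e v : symmetric e -> irreflexive e ->
  arcs R (induced e [set~ v]) = arcs R e - 2 * deg R e v.
Proof.
move=> sym_e irr_e; suff : arcs R e = arcs R (induced e [set~ v]) + deg R e v + deg R e v by lra.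
have degC : deg R e v = \sum_a (e a v)%:R.
  by apply: eq_bigr => a _; rewrite sym_e.
rewrite {2}degC /arcs.
have -> : deg R e v = \sum_a \sum_b ((a == v) && e a b)%:R.
  rewrite (bigD1 v) //= [X in _ + X]big1 ?addr0 => [|a /negPf av].
    by apply: eq_bigr => b _; rewrite eqxx.
  by apply: big1 => b _; rewrite av.
have -> : \sum_a (e a v)%:R = \sum_a \sum_b ((b == v) && e a b)%:R :> R.
  apply: eq_bigr => a _; rewrite (bigD1 v) //= [X in _ + X]big1 ?addr0 ?eqxx // => b /negPf bv.
  by rewrite bv.
rewrite -!big_split; apply: eq_bigr => a _; rewrite -!big_split; apply: eq_bigr => b _ /=.
rewrite /induced !inE; have [->|_] := eqVneq a v; have [->|_] := eqVneq b v;
  by rewrite ?irr_e /= ?addr0 ?add0r.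
Qed.

(** The Perron vector with its entry at [v] set to 0 is a test vector for the smaller graph. *)
Lemma spec_rad_delete e x v : symmetric e -> irreflexive e -> perron e x ->
  spec_rad e R * (1 - 2 * x v ^+ 2) <=
    spec_rad (induced e [set~ v]) R * (1 - x v ^+ 2).
Proof.
move=> sym_e irr_e xP; have [x_ge0 x1 xE] := xP.
pose y u := if u == v then 0 else x u.
have := le_spec_rad y (induced_sym [set~ v] sym_e).
have -> : \sum_u y u ^+ 2 = 1 - x v ^+ 2.
  rewrite -x1 (bigD1 v) //= [in RHS](bigD1 v) //= /y eqxx expr0n add0r addrAC subrr add0r.
  by apply: eq_bigr => u /negPf->.
suff -> : \sum_u \sum_z (induced e [set~ v] u z)%:R * (y u * y z) =
    spec_rad e R * (1 - 2 * x v ^+ 2) by [].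
have term u z : (induced e [set~ v] u z)%:R * (y u * y z) =
    (e u z)%:R * (x u * x z) - (u == v)%:R * ((e u z)%:R * (x u * x z))
     - (z == v)%:R * ((e u z)%:R * (x u * x z)).
  rewrite /induced /y !inE.
  have [->|_] := eqVneq u v; have [->|_] := eqVneq z v; rewrite ?irr_e /= ?mul1r ?mul0r; ring.
transitivity (\sum_u \sum_z ((e u z)%:R * (x u * x z) - (u == v)%:R * ((e u z)%:R * (x u * x z))
     - (z == v)%:R * ((e u z)%:R * (x u * x z)))).
  by apply: eq_bigr => u _; apply: eq_bigr => z _; apply: term.
under eq_bigr do rewrite !sumrB; rewrite !sumrB -(perron_quad xP).
have lx : \sum_z (e v z)%:R * (x v * x z) = spec_rad e R * x v ^+ 2.
  by rewrite expr2 mulrCA xE mulr_sumr; apply: eq_bigr => z _; rewrite mulrCA.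
have -> : \sum_u \sum_z (u == v)%:R * ((e u z)%:R * (x u * x z)) = spec_rad e R * x v ^+ 2.
  rewrite (bigD1 v) //= [X in _ + X]big1 ?addr0 => [|u /negPf uv].
    by rewrite -lx; apply: eq_bigr => z _; rewrite eqxx mul1r.
  by apply: big1 => z _; rewrite uv mul0r.
have -> : \sum_u \sum_z (z == v)%:R * ((e u z)%:R * (x u * x z)) = spec_rad e R * x v ^+ 2.
  rewrite exchange_big (bigD1 v) //= [X in _ + X]big1 ?addr0 => [|u /negPf uv].
    by rewrite -lx; apply: eq_bigr => z _; rewrite eqxx mul1r sym_e [x z * _]mulrC.
  by apply: big1 => z _; rewrite uv mul0r.
ring.
Qed.

(** Deleting [v] lowers the squared spectral radius by at least [2 * c * deg v], while
    [spec_rad_delete] limits the drop in terms of [x v ^+ 2]. Comparison with [perron_neighborhood]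
    then cancels the degree. *)
Lemma undeletable_neighborhood e x v (c : R) :
  symmetric e -> irreflexive e -> 0 < spec_rad e R -> perron e x -> 
  nonisolated e v ->
  spec_rad (induced e [set~ v]) R ^+ 2 - c * arcs R (induced e [set~ v]) <=
    spec_rad e R ^+ 2 - c * arcs R e ->
  c * (1 - x v ^+ 2) <= \sum_(u | e v u) x u ^+ 2.
Proof.
move=> sym_e irr_e l_gt0 xP v_iso; rewrite arcs_delete //.
have s_half := perron_sqr_le_half v sym_e irr_e l_gt0 xP.
have D_gt0 := deg_gt0 R v_iso.
have := perron_neighborhood v xP; have := spec_rad_delete v sym_e irr_e xP.
have s_ge0 := sqr_ge0 (x v); move: s_half s_ge0 D_gt0 l_gt0.
set l := spec_rad e R; set l' := spec_rad _ R; set D := deg R e v; set s := x v ^+ 2.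
set W := \sum_(u | _) _ => s_half s_ge0 D_gt0 l_gt0 le1 le2 le3.
have {}le1 : (l * (1 - 2 * s)) ^+ 2 <= (l' * (1 - s)) ^+ 2.
  by rewrite ler_sqr ?nnegrE // mulr_ge0 ?spec_rad_ge0 // ?subr_ge0; lra.
have s1 : 0 < 1 - s by lra.
(* This uses [(1 - s)^2 - (1 - 2s)^2 = s(2 - 3s) <= 2s(1 - s)]. *)
have le4 : c * D * (1 - s) ^+ 2 <= l ^+ 2 * s * (1 - s).
  have : l' ^+ 2 <= l ^+ 2 - 2 * c * D by lra.
  move=> /(ler_wpM2r (sqr_ge0 (1 - s))); have := mulr_ge0 (sqr_ge0 l) (sqr_ge0 s); nra.
have le5 : c * D * (1 - s) <= l ^+ 2 * s by rewrite -(ler_pM2r s1); lra.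
rewrite -(ler_pM2l D_gt0); lra.
Qed.

Lemma no_heavy_vertex e x (c d : R) :
  symmetric e -> irreflexive e -> perron e x -> 3 / 5 <= c ->
  c * arcs R e <= spec_rad e R ^+ 2 -> 0 < d ->
  (forall v, nonisolated e v -> c * (1 - x v ^+ 2) <= \sum_(u | e v u) x u ^+ 2) ->
  5 * (2 / d + 1) < spec_rad e R -> c <= 1 ->
  forall v, x v ^+ 2 <= d.
Proof.
move=> sym_e irr_e xP c_ge le_l d_gt0 nbh l_large c_le v; set l := spec_rad e R in le_l l_large.
rewrite leNgt; apply/negP => xv; have [x_ge0 x1 _] := xP.
pose K : R := 2 / d; have K_gt0 : 0 < K by rewrite divr_gt0.
have Kd : K * d = 2 by rewrite mulfVK ?gt_eqF.
(* Otherwise there are at least [deg v * K >= l^2 * d * K = 2 l^2] arcs, but [c >= 3/5] allows at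
   most [(5/3) l^2]. *)
have [t evt t_small] : exists2 t, e v t & deg R e t <= K.
  apply/exists_inP; apply: contraT; rewrite negb_exists_in => /forall_inP large.
  have D1 : l ^+ 2 * d <= deg R e v.
    apply: le_trans (_ : l ^+ 2 * x v ^+ 2 <= _); first by rewrite ler_wpM2l ?sqr_ge0 // ltW.
    apply: le_trans (perron_neighborhood v xP) _; rewrite ler_piMr ?deg_ge0 //.
    rewrite -x1 [leRHS](bigID (e v)) /= lerDl.
    by apply: sumr_ge0 => u _; apply: sqr_ge0.
  have D2 : deg R e v * K <= arcs R e.
    rewrite /arcs [leRHS](bigID (e v)) /= -[leLHS]addr0 lerD //; last first.
      by apply: sumr_ge0 => u _; apply: deg_ge0.
    rewrite degE -sum1_card natr_sum mulr_suml [leLHS](eq_bigl (e v)) => [|u]; last by rewrite inE.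
    by apply: ler_sum => u evu; rewrite mul1r ltW // ltNge large.
  have l2 : 0 < l ^+ 2 by rewrite exprn_gt0 //; move: l_large; rewrite -/K; lra.
  have : l ^+ 2 * d * K <= deg R e v * K by rewrite ler_pM2r.
  rewrite -mulrA [d * K]mulrC Kd; nra.
have t_iso : nonisolated e t by apply/existsP; exists v; rewrite sym_e.
pose S := t |: [set u | e t u].
have S_card : #|S|%:R <= 1 + K.
  apply: le_trans (_ : (1 + #|[set u | e t u]|)%:R <= _).
    by rewrite ler_nat cardsU1; case: (_ \notin _); rewrite ?leqnn ?leqnSn.
  by rewrite natrD -degE lerD2l.
have S_weight : c <= \sum_(u in S) x u ^+ 2.
  rewrite big_setU1 ?inE ?irr_e //= (eq_bigl (e t)) => [|u]; last by rewrite inE.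
  have := nbh t t_iso; have := sqr_ge0 (x t); nra.
(* A weight of at least 3/5 would give [l / 5 <= 1 + K]. *)
have := heavy_set S sym_e xP; rewrite -/l.
move: l_large; rewrite -/K; nra.
Qed.

End InducedSubgraph.

(** * Reduction to r-partite graphs and conclusion *)

Lemma F_free_induced (V VF : finType) (e : rel V) (eF : rel VF) U :
  F_free e eF -> F_free (induced e U) eF.
Proof.
move=> Ffree [f [f_inj fe]]; apply: Ffree; exists f; split=> // x y /fe.
by case/and3P.
Qed.

Lemma arcs_induced_full (R : rcfType) (V : finType) (e : rel V) U :
  arcs R e <= arcs R (induced e U) -> forall u v, e u v -> induced e U u v.
Proof.
move=> le_arcs u v euv.
pose F u v : R := (e u v)%:R - (induced e U u v)%:R.
have F_ge0 a b : 0 <= F a b.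
  by rewrite subr_ge0 ler_nat /induced; case: (a \in U); case: (b \in U).
have F0 : \sum_a \sum_b F a b = 0.
  apply/eqP; rewrite eq_le; apply/andP; split; last first.
    by apply: sumr_ge0 => a _; apply: sumr_ge0.
  by under eq_bigr do rewrite sumrB; rewrite sumrB subr_le0.
have F0u : \sum_b F u b = 0.
  by apply: (psumr_eq0_all _ F0) => a; apply: sumr_ge0.
have := psumr_eq0_all (F_ge0 u) F0u v; rewrite /F euv; case: (induced _ _ _ _) => //.
by rewrite subr0 => /eqP; rewrite oner_eq0.
Qed.

Lemma large_spec_rad_partite (VF : finType) (eF : rel VF) (r : nat) :
  symmetric eF -> irreflexive eF -> (3 <= r)%N -> chi eF = r.+1 -> color_critical eF ->
  exists m0 : nat, forall (R : rcfType) (V : finType) (e : rel V),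
    symmetric e -> irreflexive e -> F_free e eF -> (m0 <= #|edges e|)%N ->
    (1 - r%:R^-1) * arcs R e <= spec_rad e R ^+ 2 ->
    exists p : V -> 'I_r, forall u v, e u v -> p u != p v.
Proof.
move=> symF irrF r_ge3 chiF critF.
have [x [y xyF]] := color_critical_pair irrF chiF critF.
have r_gt0 : (0 < r)%N by apply: leq_trans r_ge3.
have [N0 N0P] := dense_partite symF irrF xyF r_gt0.
(* With [d = 1/(2N)], the summand 10 gives [d <= 1/20], hence [c' >= 3/5], and [N0] gives
   [2 * d * N0 <= 1]. The bound on the edges yields a spectral radius above
   [5 * (2/d + 1) = 5 * (4N + 1)] for the chosen subgraph. *)
pose N := (N0 + 10)%N; exists (100 * N * (4 * N + 1) ^ 2)%N.
move=> R V e sym_e irr_e Ffree m_large l_large.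
pose c : R := 1 - r%:R^-1; pose d : R := (2 * N%:R)^-1; pose c' : R := c * (1 - d).
have N_ge : 10 <= N%:R :> R by rewrite (ler_nat R 10) leq_addl.
have N_gt0 : 0 < N%:R :> R by lra.
have dN : d * N%:R = 1 / 2.
  by rewrite /d; field; rewrite gt_eqF.
have d_gt0 : 0 < d by rewrite invr_gt0; lra.
have c_ge0 : 0 <= c.
  by rewrite subr_ge0 invf_le1 ?ler1n ?ltr0n.
have d_le : d <= 1 / 20 by nra.
have c_ge : 2 / 3 <= c.
  rewrite /c; suff : r%:R^-1 <= 1 / 3 :> R by lra.
  by rewrite div1r lef_pV2 ?posrE ?ltr0n // ler_nat.
have c_le : c <= 1 by rewrite gerBl invr_ge0.
have c'_ge : 3 / 5 <= c' by rewrite /c'; nra.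
have c'_le : c' <= 1 by rewrite /c'; nra.
(* As [c' < c], the whole graph has [Psi] at least [c * d * arcs R e]; a maximizer inherits this
   surplus, hence a large spectral radius. *)
pose Psi (U : {set V}) : R := spec_rad (induced e U) R ^+ 2 - c' * arcs R (induced e U).
have [U _ Umax] : exists2 U, true & forall U', Psi U' <= Psi U.
  case: (@arg_maxP _ R {set V} [set: V] predT Psi isT) => U _ Umax.
  by exists U => // U'; apply: Umax.
set e' := induced e U.
have sym_e' : symmetric e' by apply: induced_sym.
have irr_e' : irreflexive e' by apply: induced_irr.
have D_ge0 := arcs_ge0 R e; have D'_ge0 := arcs_ge0 R e'.
have l'_ge : c' * arcs R e' + c * d * arcs R e <= spec_rad e' R ^+ 2.
  have := Umax [set: V]; rewrite /Psi -/e'.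
  rewrite (eq_spec_rad R (inducedT e)) (eq_arcs R (inducedT e)).
  move: l_large; rewrite -/c /c'; lra.
have cdD_ge : (5 * (2 / d + 1)) ^+ 2 < c * d * arcs R e.
  have -> : 2 / d = 4 * N%:R by rewrite /d invrK; ring.
  pose K : R := (4 * N%:R + 1) ^+ 2.
  have m_ge : 100 * N%:R * K <= #|edges e|%:R.
    by have := m_large; rewrite -(ler_nat R) natrM natrX natrD !natrM.
  have K_gt0 : 0 < K by rewrite exprn_gt0 //; lra.
  have dD : 100 * K <= d * arcs R e.
    rewrite arcs_edges // natrM; move: m_ge => /(ler_wpM2l (ltW d_gt0)).
    have -> : d * (100 * N%:R * K) = 50 * K.
      by transitivity (d * N%:R * (100 * K)); [ring | rewrite dN; field].
    lra.
  have : 2 / 3 * (d * arcs R e) <= c * (d * arcs R e).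
    by rewrite ler_wpM2r // mulr_ge0 // ltW.
  by move: dD K_gt0; rewrite mulrA exprMn -/K; lra.
have l'_large : 5 * (2 / d + 1) < spec_rad e' R.
  have A0 : 0 <= 5 * (2 / d + 1) by rewrite mulr_ge0 // addr_ge0 // divr_ge0 // ltW.
  rewrite -ltr_sqr ?nnegrE ?spec_rad_ge0 //; apply: lt_le_trans cdD_ge _.
  by apply: le_trans l'_ge; rewrite lerDr mulr_ge0 //; lra.
have l'_gt0 : 0 < spec_rad e' R.
  by apply: le_lt_trans l'_large; rewrite mulr_ge0 // addr_ge0 // divr_ge0 // ltW.
have [z zP] := perron_vector sym_e' l'_gt0.
have nbh v : nonisolated e' v -> c' * (1 - z v ^+ 2) <= \sum_(u | e' v u) z u ^+ 2.
  move=> v_iso; apply: (undeletable_neighborhood sym_e' irr_e' l'_gt0 zP v_iso).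
  have := Umax (U :\ v).
  by rewrite /Psi (eq_spec_rad R (induced_setD1 e U v)) (eq_arcs R (induced_setD1 e U v)).
have z_small : forall v, z v ^+ 2 <= d.
  apply: (no_heavy_vertex sym_e' irr_e' zP c'_ge _ d_gt0 nbh l'_large c'_le).
  by apply: le_trans l'_ge; rewrite lerDl !mulr_ge0 // ltW.
have e'_dense : dense_weight e' (fun v => z v ^+ 2) r (2 * d).
  have [_ z1 _] := zP; split=> // [v|v v_iso|v v_iso].
  - rewrite sqr_ge0 /=; apply: le_trans (z_small v) _; lra.
  - by rewrite (perron_isolated l'_gt0 zP v_iso) expr0n.
  apply: le_trans (nbh v v_iso); rewrite -/c /c'.
  have cd : c * d <= d by rewrite ger_pMl.
  have cs : c * z v ^+ 2 <= z v ^+ 2 by rewrite ler_piMl ?sqr_ge0.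
  have cds : 0 <= c * d * z v ^+ 2 by apply: mulr_ge0 (sqr_ge0 _); rewrite mulr_ge0 // ltW.
  have := z_small v; lra.
have [|p p_proper] := N0P R V e' _ (2 * d) sym_e' irr_e' (F_free_induced Ffree) e'_dense.
  have : N0%:R <= N%:R :> R by rewrite ler_nat leq_addr.
  nra.
have := partite_spec_rad_le l'_gt0 zP p_proper; rewrite -/c => l'_le.
(* The partite upper bound [c * arcs R e'] meets the lower bound
   [c' * arcs R e' + c * d * arcs R e], so no arc was lost and the classes of [e'] serve for [e]. *)
have le_arcs : arcs R e <= arcs R e'.
  have : c * d * arcs R e <= c * d * arcs R e' by move: l'_le l'_ge; rewrite /c'; lra.
  by rewrite ler_pM2l // mulr_gt0 //; lra.
by exists p => u v /(arcs_induced_full le_arcs)/p_proper.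
Qed.

Theorem theorem1p5 (VF : finType) (eF : rel VF) (r : nat) :
  symmetric eF -> irreflexive eF ->
  (3 <= r)%N -> chi eF = r.+1 -> color_critical eF ->
  exists m0 : nat, forall m : nat, (m0 <= m)%N ->
    forall (R : rcfType) (V : finType) (e : rel V),
      symmetric e -> irreflexive e -> F_free e eF -> #|edges e| = m ->
      spec_rad e R ^+ 2 <= (1 - r%:R^-1) * (2 * m)%:R /\
      (spec_rad e R ^+ 2 = (1 - r%:R^-1) * (2 * m)%:R <->
         regular_complete_partite e r).
Proof.
move=> symF irrF r_ge3 chiF critF.
have [m0 m0P] := large_spec_rad_partite symF irrF r_ge3 chiF critF.
(* The successor guarantees an edge, hence a positive number of arcs. *)
exists m0.+1 => m lt_m R V e sym_e irr_e Ffree mE.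
have DE : (2 * m)%:R = arcs R e by rewrite arcs_edges // mE.
have D_gt0 : 0 < arcs R e by rewrite -DE ltr0n muln_gt0 (leq_ltn_trans _ lt_m).
have r_gt0 : (0 < r)%N by apply: leq_trans r_ge3.
have regular_eq := spec_rad_regular_complete_partite sym_e irr_e r_gt0 D_gt0.
(* Below the bound both sides of the equivalence fail, since regular complete [r]-partite graphs
   attain it; otherwise the graph is [r]-partite. *)
rewrite DE; have [lt_l|le_l] := ltP (spec_rad e R ^+ 2) ((1 - r%:R^-1) * arcs R e).
  split; first exact: ltW.
  by split=> [l_eq|/regular_eq//]; rewrite l_eq ltxx in lt_l.
have [|p p_proper] := m0P R V e sym_e irr_e Ffree _ le_l; first by rewrite mE ltnW.
have l_gt0 : 0 < spec_rad e R.
  rewrite lt_def spec_rad_ge0 andbT; apply: contraTneq le_l => ->.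
  rewrite expr0n -ltNge mulr_gt0 // subr_gt0 invf_lt1 ?ltr0n // ltr1n.
  exact: leq_trans r_ge3.
have [x xP] := perron_vector sym_e l_gt0.
split; first exact: (partite_spec_rad_le l_gt0 xP p_proper).
by split=> [|/regular_eq//]; apply: (partite_spec_rad_eq l_gt0 xP p_proper r_ge3).
Qed.
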